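(* Let $M$ be a finite-dimensional Riemannian manifold, $U\subset M$ a normal convex neighborhood, $n\ge 1$ an integer, $\mathcal{M}:=M^n$ the power manifold with its Riemannian metric $g$, and $\mathcal{U}:=U^n$. Let $\mathrm{Exp}$ and $\mathrm{Log}$ denote the Riemannian exponential and logarithmic maps of $\mathcal{M}$. Fix $\mu\in\mathcal{U}$, let $S$ be a positive definite self-adjoint endomorphism of $T_\mu\mathcal{M}$, and let $W$ be a positive definite endomorphism of $T_\mu\mathcal{M}$ with $W^tW=S$, where $W^t$ is the adjoint of $W$ with respect to $g_\mu$ (for example, the unique positive definite symmetric square root of $S$). Consider the function $f$ defined on $\mathcal{U}$ by $$f(x)=g_\mu\big(S\,\mathrm{Log}_\mu x,\ \mathrm{Log}_\mu x\big).$$ Fix $x\in\mathcal{U}$. Let $\gamma$ be the geodesic given by $\gamma(t)=\mathrm{Exp}_\mu(t\,\mathrm{Log}_\mu x)$ with $t\in[0,1]$. Then $$\mathrm{grad}_x f = 2\,(d_x\mathrm{Log}_\mu)^\dagger\, S\,\mathrm{Log}_\mu x ,$$ where the superscript $\dagger$ represents the adjoint. Moreover, let $k$ be the function defined on $\mathcal{U}$ by $k(x)=\mathrm{Exp}_\mu(W\,\mathrm{Log}_\mu x)$, and denote the tangent map of $k$ evaluated at $x$ by $d_xk$. Then $$\mathrm{grad}_x f=-2\,(d_xk)^\dagger\,\mathrm{Log}_{k(x)}\mu .$$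
   Context: A normal convex (also called totally normal) neighborhood $U\subset M$ is one within which geodesics are unique and length-minimizing. The exponential map at $p$ sends a tangent vector $v$ to the endpoint (at time $1$) of the geodesic starting at $p$ with initial velocity $v$; the logarithmic map at $p$ is its local inverse, sending $q$ to the initial velocity of the geodesic connecting $p$ to $q$. The power manifold $\mathcal{M}=M^n$ carries the product metric $g$, and its maps $\mathrm{Exp}$ and $\mathrm{Log}$ act componentwise through the exponential and logarithmic maps of $M$. The differential $d_x\mathrm{Log}_\mu$ is regarded as a linear map $T_x\mathcal{M}\to T_\mu\mathcal{M}$ (identifying tangent spaces of the vector space $T_\mu\mathcal{M}$ with $T_\mu\mathcal{M}$ itself), and $d_xk$ is a linear map $T_x\mathcal{M}\to T_{k(x)}\mathcal{M}$. For a linear map $F:T_x\mathcal{M}\to T_y\mathcal{M}$, the adjoint $F^\dagger:T_y\mathcal{M}\to T_x\mathcal{M}$ is determined by $g_y(Fv,w)=g_x(v,F^\dagger w)$ for all $v\in T_x\mathcal{M}$, $w\in T_y\mathcal{M}$. The gradient $\mathrm{grad}_xf\in T_x\mathcal{M}$ is determined by $d_xf(v)=g_x(\mathrm{grad}_xf,v)$ for all $v\in T_x\mathcal{M}$, where $d_xf$ is the differential of $f$ at $x$. The function $f$ is a squared Mahalanobis distance when $\mu$ is the mean of a sample in $\mathcal{M}$ and $S$ is the inverse of its covariance operator on $T_\mu\mathcal{M}$.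
   Formalization: The second gradient formula is proved under the added assumption that W Log_μ x lies in Log_μ(U^n), so that Log_μ k(x) = W Log_μ x; without it Log_{k(x)} μ may be undefined or the formula false (on a sphere with W a large multiple of the identity). *)

(* Defs.v *)
From HB Require Import structures.
From mathcomp Require Export all_boot all_order all_algebra.
From mathcomp Require Export all_classical all_reals all_analysis.

Set Implicit Arguments.
Unset Strict Implicit.
Unset Printing Implicit Defensive.

Import Order.TTheory GRing.Theory Num.Theory.
Import numFieldNormedType.Exports.

Local Open Scope classical_set_scope.
Local Open Scope ring_scope.

(* Only used with V finite-dimensional, where "Frechet differentiable on O with
   all directional derivatives of class C^k" is the usual C^(k+1).  O is open
   in all uses, so the values of f outside O are irrelevant. *)
Fixpoint Ck (R : realType) (V W : normedModType R) (k : nat) (O : set V)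
    (f : V -> W) : Prop :=
  match k with
  | 0 => forall x, O x -> {for x, continuous f}
  | k'.+1 => (forall x, O x -> differentiable f x) /\
             (forall v, Ck k' O (fun x => 'D_v f x))
  end.

Definition smooth_on (R : realType) (V W : normedModType R) (O : set V)
    (f : V -> W) : Prop := forall k, Ck k O f.

(* Homeomorphisms between open subsets of T and E; both maps are total
   functions whose values outside cdom, resp. ccod, are irrelevant. *)
Record chart (R : realType) (E : normedModType R) (T : topologicalType) := Chart {
  cdom : set T;
  ccod : set E;
  cmap : T -> E;
  cinv : E -> T;
  cdom_open : open cdom;
  ccod_open : open ccod;
  cmap_cod : forall p, cdom p -> ccod (cmap p);
  cinv_dom : forall y, ccod y -> cdom (cinv y);
  cmapK : forall p, cdom p -> cinv (cmap p) = p;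
  cinvK : forall y, ccod y -> cmap (cinv y) = y;
  cmap_cont : forall p, cdom p -> {for p, continuous cmap};
  cinv_cont : forall y, ccod y -> {for y, continuous cinv}
}.

(* chart_at p is a preferred chart around p: a tangent vector at p is encoded
   by its coordinates in that chart.  gram a y u v is the metric in the chart
   a, at the point of coordinates y, of the tangent vectors with coordinates
   u and v. *)
Record riemannian (R : realType) (E : normedModType R) := Riemannian {
  carrier :> topologicalType;
  manifold_hausdorff : hausdorff_space carrier;
  manifold_second_countable : @second_countable carrier;
  atlas : Type;
  chart_of : atlas -> chart E carrier;
  chart_at : carrier -> atlas;
  chart_atP : forall p, cdom (chart_of (chart_at p)) p;
  transition_smooth : forall a b,
    smooth_on (cmap (chart_of a) @`
                 (cdom (chart_of a) `&` cdom (chart_of b)))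
              (cmap (chart_of b) \o cinv (chart_of a));
  gram : atlas -> E -> E -> E -> R;
  gram_sym : forall a y, ccod (chart_of a) y ->
    forall u v, gram a y u v = gram a y v u;
  gram_linear : forall a y, ccod (chart_of a) y ->
    forall u k v w, gram a y u (k *: v + w) = k * gram a y u v + gram a y u w;
  gram_posdef : forall a y, ccod (chart_of a) y ->
    forall u, u != 0 -> 0 < gram a y u u;
  gram_smooth : forall a u v,
    smooth_on (ccod (chart_of a)) (fun y => gram a y u v);
  gram_compat : forall a b p,
    cdom (chart_of a) p -> cdom (chart_of b) p ->
    forall u v,
      let D := 'd (cmap (chart_of b) \o cinv (chart_of a))
                  (cmap (chart_of a) p) in
      gram a (cmap (chart_of a) p) u v =
      gram b (cmap (chart_of b) p) (D u) (D v)
}.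

Lemma near_diff (R : realType) (V W : normedModType R) (f g : V -> W) x :
  (\forall y \near x, f y = g y) -> differentiable f x ->
  differentiable g x /\ 'd g x = 'd f x :> (V -> W).
Proof.
move=> fg df.
have c : continuous ('d f x) by apply: diff_continuous.
have E : g \o shift x = cst (g x) + 'd f x +o_ 0 id.
  apply/eqaddoP => e e0.
  have := diff_locally df; move/eqaddoP => /(_ e e0) H.
  have fgx : f x = g x by exact: (nbhs_singleton fg).
  have fg0 : \forall h \near 0, f (h + x) = g (h + x).
    by move: fg; rewrite (near_shift 0) subr0 /=; apply.
  near=> h.
  have : `|(f \o shift x - (cst (f x) + 'd f x)) h| <= e * `|h| by near: h.
  rewrite /= !fctE /= -fgx; congr (`| _ - _ | <= _).
  by near: h.
have D := diff_unique c E.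
split=> //; apply/diff_locallyP; rewrite D; split => //.
Unshelve. all: by end_near. Qed.

Lemma Ck_ext (R : realType) (V W : normedModType R) k (O : set V) (f g : V -> W) :
  open O -> (forall x, O x -> f x = g x) -> Ck k O f -> Ck k O g.
Proof.
move=> oO; have nO x (P : V -> Prop) : O x -> (forall x, O x -> P x) -> \forall y \near x, P y.
  by move=> Ox OP; apply: filterS (open_nbhs_nbhs (conj oO Ox)).
elim: k f g => [|k IH] f g fg /=.
  move=> cf x Ox; have cfx : f @ x --> f x := cf x Ox.
  suff : g @ x --> g x by [].
  rewrite -(fg _ Ox); apply: cvg_trans cfx; apply: near_eq_cvg.
  by apply: nO => // y /fg.
case=> dff Cf; split=> [x Ox|v].
  by apply: (near_diff _ (dff _ Ox)).1; apply: nO.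
apply: IH (Cf v) => x Ox; apply: near_eq_derive; apply: nO => // y Oy; exact: fg.
Qed.

Lemma mx_cont_at (R : realType) (T : topologicalType) m n (f : T -> 'M[R]_(m, n)) x :
  (forall i j, {for x, continuous (fun t => f t i j)}) -> {for x, continuous f}.
Proof.
move=> cf A [P Py PA] /=.
have H : \forall t \near x, forall i j, P i j (f t i j).
  by apply: filter_forall => i; apply: filter_forall => j; apply: cf; apply: Py.
by apply: filterS H => t; exact: PA.
Qed.

Lemma mx_cont (R : realType) (T : topologicalType) m n (f : T -> 'M[R]_(m, n)) :
  (forall i j, continuous (fun t => f t i j)) -> continuous f.
Proof. by move=> cf x; apply: mx_cont_at => i j; exact: cf. Qed.

Section blk.
Context {R : realType} {n d e : nat}.

Lemma row_cont i : continuous (row i : 'M[R]_(n, d) -> 'rV[R]_d).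
Proof.
apply: mx_cont => k j; under eq_fun do rewrite mxE.
exact: coord_continuous.
Qed.

Lemma open_row_box (O : 'I_n -> set 'rV[R]_d) : (forall i, open (O i)) ->
  open [set y : 'M[R]_(n, d) | forall i, O i (row i y)].
Proof.
move=> oO; rewrite openE => y Oy.
suff : \forall z \near y, forall i, O i (row i z) by [].
apply: (@filter_forall _ _ _ _ (nbhs_filter y)) => i.
have Oi : nbhs (row i y) (O i) by apply: open_nbhs_nbhs; split; [exact: oO|exact: Oy].
exact: (row_cont Oi).
Qed.

Definition emb (i : 'I_n) (v : 'rV[R]_e) : 'M[R]_(n, e) :=
  \matrix_(k, j) (v 0 j *+ (k == i)).
Lemma emb_is_linear i : linear (emb i).
Proof.
move=> k u v; apply/matrixP => a b; rewrite !mxE.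
by case: (a == i); rewrite ?mulr1n ?mulr0n ?mulr0 ?addr0.
Qed.
HB.instance Definition _ i := GRing.isLinear.Build R 'rV[R]_e 'M[R]_(n, e) _ (emb i) (emb_is_linear i).

Lemma emb_cont i : continuous (emb i).
Proof.
apply: mx_cont => k j; under eq_fun do rewrite mxE.
case: (k == i); last by rewrite /=; under eq_fun do rewrite mulr0n; apply: cst_continuous.
under eq_fun do rewrite mulr1n; exact: coord_continuous.
Qed.

Definition blk (F : 'I_n -> 'rV[R]_d -> 'rV[R]_e) (y : 'M[R]_(n, d)) : 'M[R]_(n, e) :=
  \matrix_(i, j) F i (row i y) 0 j.

Lemma blkE F y : blk F y = \sum_i emb i (F i (row i y)).
Proof.
apply/matrixP => k j; rewrite mxE summxE (bigD1 k) //= mxE eqxx mulr1n.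
by rewrite big1 ?addr0 // => i ik; rewrite mxE eq_sym (negbTE ik).
Qed.

Lemma row_blk F y i : row i (blk F y) = F i (row i y).
Proof. by apply/rowP => j; rewrite !mxE. Qed.

Lemma is_diff_sumf (V W : normedModType R) m (f : 'I_m -> V -> W) (df : 'I_m -> V -> W) x :
  (forall i, is_diff x (f i) (df i)) -> is_diff x (\sum_i f i) (\sum_i df i).
Proof.
move=> H; elim/big_ind2 : _ => //; first exact: is_diff_cst.
by move=> ? ? ? ? ? ?; exact: is_diffD.
Qed.

Lemma is_diff_row (W : normedModType R) (F : 'rV[R]_d -> W) i y :
  differentiable F (row i y) ->
  is_diff (y : 'M[R]_(n, d)) (F \o row i) ('d F (row i y) \o row i).
Proof.
move=> dF.
have dr : is_diff (y : 'M[R]_(n, d)) (row i : 'M[R]_(n, d) -> 'rV[R]_d) (row i).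
  pose L : {linear 'M[R]_(n, d) -> 'rV[R]_d} := row i.
  have cL : continuous L := @row_cont i.
  apply: DiffDef; first exact: (linear_differentiable y cL).
  exact: (diff_lin y cL).
have dF' : is_diff (row i y) F ('d F (row i y)) by apply: DiffDef.
exact: is_diff_comp.
Qed.

Lemma is_diff_blk F y : (forall i, differentiable (F i) (row i y)) ->
  is_diff y (blk F) (blk (fun i => 'd (F i) (row i y))).
Proof.
move=> dF.
have -> : blk F = \sum_i (emb i \o (F i \o row i)).
  by apply/funext => z; rewrite blkE fct_sumE.
have -> : blk (fun i => 'd (F i) (row i y)) = \sum_i (emb i \o ('d (F i) (row i y) \o row i)).
  by apply/funext => z; rewrite blkE fct_sumE.
apply: is_diff_sumf => i.
have de z : is_diff z (emb i) (emb i).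
  apply: DiffDef; first exact: (linear_differentiable z (@emb_cont i)).
  exact: (diff_lin z (@emb_cont i)).
have dr := is_diff_row (dF i).
exact: is_diff_comp.
Qed.

Lemma derive_blk F y v : (forall i, differentiable (F i) (row i y)) ->
  'D_v (blk F) y = blk (fun i => cst ('D_(row i v) (F i) (row i y))) 0.
Proof.
move=> dF; have D := is_diff_blk dF.
rewrite deriveE; last exact: ex_diff.
rewrite diff_val; apply/matrixP => i j; rewrite !mxE.
by rewrite deriveE //.
Qed.

Lemma Ck_blk k (O : 'I_n -> set 'rV[R]_d) F : (forall i, open (O i)) ->
  (forall i, Ck k (O i) (F i)) -> Ck k [set y | forall i, O i (row i y)] (blk F).
Proof.
move=> oO; elim: k F => [|k IH] F /= CF.
  move=> y Oy.
  have -> : blk F = \sum_i (emb i \o (F i \o row i)).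
    by apply/funext => z; rewrite blkE fct_sumE.
  elim/big_ind: _.
  - exact: cst_continuous.
  - by move=> f g cf cg; apply: continuousD.
  - move=> i _; apply: continuous_comp; last exact: emb_cont.
    apply: continuous_comp; first exact: row_cont.
    exact: CF.
split=> [y Oy|v].
  by have [] := @is_diff_blk F y (fun i => (CF i).1 _ (Oy i)).
have oB := open_row_box oO.
apply: (Ck_ext oB) (IH (fun i => 'D_(row i v) (F i)) (fun i => (CF i).2 _)) => y Oy.
rewrite derive_blk; last by move=> i; exact: (CF i).1.
by apply/matrixP => i j; rewrite !mxE.
Qed.

Lemma Ck_sum_row k (O : 'I_n -> set 'rV[R]_d) (F : 'I_n -> 'rV[R]_d -> R) :
  (forall i, open (O i)) -> (forall i, Ck k (O i) (F i)) ->
  Ck k [set y : 'M[R]_(n, d) | forall i, O i (row i y)]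
    (fun y => \sum_i F i (row i y)).
Proof.
move=> oO; elim: k F => [|k IH] F /= CF.
  move=> y Oy.
  have -> : (fun y => \sum_i F i (row i y)) = \sum_i (F i \o row i).
    by apply/funext => z; rewrite fct_sumE.
  elim/big_ind: _.
  - exact: cst_continuous.
  - by move=> f g cf cg; apply: continuousD.
  - move=> i _; apply: continuous_comp; first exact: row_cont.
    exact: CF.
have D y : (forall i, O i (row i y)) ->
    is_diff y (fun y => \sum_i F i (row i y)) (\sum_i ('d (F i) (row i y) \o row i)).
  move=> Oy.
  have -> : (fun y => \sum_i F i (row i y)) = \sum_i (F i \o row i).
    by apply/funext => z; rewrite fct_sumE.
  by apply: is_diff_sumf => i; apply: is_diff_row; apply: (CF i).1.
split=> [y Oy|v]; first by have [] := D y Oy.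
have oB := open_row_box oO.
apply: (Ck_ext oB) (IH (fun i => 'D_(row i v) (F i)) (fun i => (CF i).2 _)) => y Oy.
have Dy := D y Oy.
rewrite [RHS]deriveE; last exact: ex_diff.
rewrite diff_val fct_sumE; apply: eq_bigr => i _ /=.
by rewrite deriveE //; apply: (CF i).1.
Qed.

End blk.

(* The power manifold: charts are products of charts of M, a tangent vector is
   encoded by the matrix whose i-th row is its i-th component, and the metric is
   the sum of the metrics of the factors. *)
Section power.
Context {R : realType} {d : nat} (M : riemannian 'rV[R]_d) (n : nat).

Definition power_space : topologicalType := prod_topology (fun _ : 'I_n => M : topologicalType).

Lemma power_proj_cont (i : 'I_n) : continuous (fun x : power_space => x i).
Proof. exact: (@proj_continuous _ (fun _ : 'I_n => M : topologicalType)). Qed.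

Lemma power_cont_at (T : topologicalType) (f : T -> power_space) x :
  (forall i, {for x, continuous (fun t => f t i)}) -> {for x, continuous f}.
Proof.
move=> cf; apply/cvg_sup => i A [_ [[B oB <-]] /= Bfx BA].
have nB : nbhs (f x i) B by apply: open_nbhs_nbhs.
have H : \forall t \near x, B (f t i) := cf i B nB.
by apply: (filterS _ H) => t Bt; exact: BA.
Qed.

Lemma power_box_open (D : 'I_n -> set M) : (forall i, open (D i)) ->
  open ([set x | forall i, D i (x i)] : set power_space).
Proof.
move=> oD; rewrite openE => x Dx.
apply: (@filter_forall _ _ _ _ (nbhs_filter (x : power_space))) => i.
have Di : nbhs (x i) (D i) by apply: open_nbhs_nbhs; split; [exact: oD|exact: Dx].
exact: (@power_proj_cont i x _ Di).
Qed.

Lemma power_hausdorff : hausdorff_space power_space.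
Proof.
apply: (@hausdorff_product _ (fun _ : 'I_n => M : topologicalType)) => _.
exact: manifold_hausdorff.
Qed.

Lemma power_nbhs_box (x : power_space) A : nbhs x A ->
  exists2 D : 'I_n -> set M, (forall i, nbhs (x i) (D i)) &
    [set y | forall i, D i (y i)] `<=` A.
Proof.
pose F : set_system power_space := filter_from
  [set D : 'I_n -> set M | forall i, nbhs (x i) (D i)]
  (fun D => [set y | forall i, D i (y i)]).
have FF : Filter F.
  apply: filter_from_filter; first by exists (fun=> setT) => i; apply: filterT.
  move=> D D' nD nD'; exists (fun i => D i `&` D' i) => [i|y yD]; first exact: filterI.
  by split=> i; have [] := yD i.
have : F --> x.
  apply/cvg_sup => i B [_ [[C oC <-]] /= Cx CB].
  exists (fun j => if j == i then C else setT) => [j|y yD] /=.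
    by case: eqP => [->|_]; [apply: open_nbhs_nbhs|exact: filterT].
  by apply: CB => /=; have := yD i; rewrite eqxx.
by move=> Fx /Fx.
Qed.

Lemma power_second_countable : @second_countable power_space.
Proof.
have [B cB [oB bB]] := @manifold_second_countable _ _ M.
pose box (D : 'I_n -> set M) : set power_space := [set x | forall i, D i (x i)].
exists (box @` [set D | forall i, B (D i)]).
  apply: card_le_trans (card_image_le _ _) _.
  have /countable_injP[f finj] := cB.
  apply/countable_injP; exists (fun D => pickle [ffun i => f (D i)]).
  move=> D D' /set_mem BD /set_mem BD' /(pcan_inj pickleK) /ffunP E.
  apply/funext => i; apply: finj; rewrite ?inE //.
  by have := E i; rewrite !ffunE.
split=> [_ [D BD <-]|x A nA].
  by apply: power_box_open => i; apply: oB; exact: BD.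
have [D nD DA] := power_nbhs_box nA.
have /choice [C HC] : forall i, exists C, [/\ B C, C (x i) & C `<=` D i].
  by move=> i; have [C [BC Cx] CD] := bB (x i) (D i) (nD i); exists C.
exists (box C); first split.
- by exists C => // i; have [] := HC i.
- by move=> i; have [] := HC i.
- by move=> y Cy; apply: DA => i; have [_ _] := HC i; apply; exact: Cy.
Qed.

Definition power_map (a : 'I_n -> atlas M) (x : power_space) : 'M[R]_(n, d) :=
  \matrix_(i, j) cmap (chart_of (a i)) (x i) 0 j.

Definition power_inv (a : 'I_n -> atlas M) (y : 'M[R]_(n, d)) : power_space :=
  fun i => cinv (chart_of (a i)) (row i y).

Definition power_dom (a : 'I_n -> atlas M) : set power_space :=
  [set x | forall i, cdom (chart_of (a i)) (x i)].

Definition power_cod (a : 'I_n -> atlas M) : set 'M[R]_(n, d) :=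
  [set y | forall i, ccod (chart_of (a i)) (row i y)].

Lemma row_power_map a x i : row i (power_map a x) = cmap (chart_of (a i)) (x i).
Proof. by apply/rowP => j; rewrite !mxE. Qed.

Lemma power_dom_open a : open (power_dom a).
Proof.
by apply: (@power_box_open (fun i => cdom (chart_of (a i)))) => i; exact: cdom_open.
Qed.

Lemma power_cod_open a : open (power_cod a).
Proof.
by apply: (@open_row_box _ _ _ (fun i => ccod (chart_of (a i)))) => i; exact: ccod_open.
Qed.

Lemma power_map_cod a x : power_dom a x -> power_cod a (power_map a x).
Proof. by move=> ax i; rewrite row_power_map; apply: cmap_cod. Qed.

Lemma power_inv_dom a y : power_cod a y -> power_dom a (power_inv a y).
Proof. by move=> ay i; apply: cinv_dom. Qed.

Lemma power_mapK a x : power_dom a x -> power_inv a (power_map a x) = x.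
Proof. by move=> ax; apply/funext => i; rewrite /power_inv row_power_map cmapK. Qed.

Lemma power_invK a y : power_cod a y -> power_map a (power_inv a y) = y.
Proof.
move=> ay; apply/row_matrixP => i.
by rewrite row_power_map /power_inv cinvK.
Qed.

Lemma power_map_cont a x : power_dom a x -> {for x, continuous (power_map a)}.
Proof.
move=> ax; apply: mx_cont_at => i j.
have -> : (fun t => power_map a t i j) = (fun t => cmap (chart_of (a i)) (t i) 0 j).
  by apply/funext => t; rewrite mxE.
have c1 : {for x, continuous (fun x : power_space => x i)} by exact: power_proj_cont.
have c2 : {for x i, continuous (cmap (chart_of (a i)))} by apply: cmap_cont.
apply: (continuous_comp (f := cmap (chart_of (a i)) \o (fun x : power_space => x i))
  (g := fun v : 'rV[R]_d => v 0 j)).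
  exact: continuous_comp.
exact: coord_continuous.
Qed.

Lemma power_inv_cont a y : power_cod a y -> {for y, continuous (power_inv a)}.
Proof.
move=> ay; apply: power_cont_at => i.
apply: (continuous_comp (f := row i) (g := cinv (chart_of (a i)))).
  exact: row_cont.
exact/cinv_cont.
Qed.

Definition power_chart (a : 'I_n -> atlas M) : chart 'M[R]_(n, d) power_space :=
  Chart (@power_dom_open a) (@power_cod_open a) (@power_map_cod a)
    (@power_inv_dom a) (@power_mapK a) (@power_invK a) (@power_map_cont a)
    (@power_inv_cont a).

Definition power_at (x : power_space) : 'I_n -> atlas M := fun i => chart_at (x i).

Lemma power_chart_atP x : cdom (power_chart (power_at x)) x.
Proof. by move=> i; exact: chart_atP. Qed.

Lemma power_transitionE a b : power_map b \o power_inv a =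
  blk (fun i => cmap (chart_of (b i)) \o cinv (chart_of (a i))).
Proof. by apply/funext => y; apply/matrixP => i j; rewrite !mxE. Qed.

Lemma transition_dom_open (a b : atlas M) :
  open (cmap (chart_of a) @` (cdom (chart_of a) `&` cdom (chart_of b))).
Proof.
rewrite openE => _ [p [ap bp] <-].
suff : \forall y \near cmap (chart_of a) p, ccod (chart_of a) y /\
    cdom (chart_of b) (cinv (chart_of a) y).
  apply: filterS => y [ay by_]; exists (cinv (chart_of a) y); last exact: cinvK.
  by split=> //; apply: cinv_dom.
have ay : ccod (chart_of a) (cmap (chart_of a) p) by apply: cmap_cod.
apply: filterI; first by apply: open_nbhs_nbhs; split => //; exact: ccod_open.
have nb : nbhs (cinv (chart_of a) (cmap (chart_of a) p)) (cdom (chart_of b)).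
  by rewrite cmapK //; apply: open_nbhs_nbhs; split => //; exact: cdom_open.
exact: (cinv_cont ay nb).
Qed.

Lemma power_transition_smooth a b :
  smooth_on (cmap (power_chart a) @`
               (cdom (power_chart a) `&` cdom (power_chart b)))
            (cmap (power_chart b) \o cinv (power_chart a)).
Proof.
move=> k /=; rewrite power_transitionE.
pose O i := cmap (chart_of (a i)) @`
  (cdom (chart_of (a i)) `&` cdom (chart_of (b i))).
have -> : power_map a @` (power_dom a `&` power_dom b) =
    [set y | forall i, O i (row i y)].
  apply/seteqP; split=> [_ [x [ax bx] <-] i|y Oy].
    by rewrite row_power_map; exists (x i).
  have /choice [x Hx] : forall i, exists p, [/\ cdom (chart_of (a i)) p,
      cdom (chart_of (b i)) p & cmap (chart_of (a i)) p = row i y].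
    by move=> i; have [p [? ?] ?] := Oy i; exists p.
  exists x; first by split=> i; have [] := Hx i.
  by apply/row_matrixP => i; rewrite row_power_map; have [] := Hx i.
apply: Ck_blk => i; first exact: transition_dom_open.
exact: transition_smooth.
Qed.

Definition power_gram (a : 'I_n -> atlas M) (y u v : 'M[R]_(n, d)) : R :=
  \sum_i gram (a i) (row i y) (row i u) (row i v).

Lemma power_gram_sym a y : ccod (power_chart a) y ->
  forall u v, power_gram a y u v = power_gram a y v u.
Proof. by move=> ay u v; apply: eq_bigr => i _; apply: gram_sym; exact: ay. Qed.

Lemma power_gram_linear a y : ccod (power_chart a) y ->
  forall u k v w, power_gram a y u (k *: v + w) =
    k * power_gram a y u v + power_gram a y u w.
Proof.
move=> ay u k v w; rewrite /power_gram mulr_sumr -big_split /=.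
by apply: eq_bigr => i _; rewrite linearP gram_linear //; exact: ay.
Qed.

Lemma gram_ge0 (a : atlas M) y u : ccod (chart_of a) y -> 0 <= gram a y u u.
Proof.
move=> ay; have [->|u0] := eqVneq u 0; last by rewrite ltW // gram_posdef.
have := gram_linear ay 0 0 0 0; rewrite scaler0 addr0 mul0r add0r.
have := gram_linear ay 0 1 0 0; rewrite scaler0 addr0 mul1r => + _.
by move=> /eqP; rewrite -subr_eq0 opprD addNKr oppr_eq0 => /eqP ->.
Qed.

Lemma power_gram_posdef a y : ccod (power_chart a) y ->
  forall u, u != 0 -> 0 < power_gram a y u u.
Proof.
move=> ay u u0.
have [i ui] : exists i, row i u != 0.
  apply/existsP; apply: contraNT u0; rewrite negb_exists => /forallP u0.
  by apply/eqP/row_matrixP => i; rewrite row0; apply/eqP; rewrite -[_ == _]negbK.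
rewrite /power_gram (bigD1 i) //= ltr_pwDl //; first by apply: gram_posdef => //; exact: ay.
by apply: sumr_ge0 => j _; apply: gram_ge0; exact: ay.
Qed.

Lemma power_gram_smooth a u v :
  smooth_on (ccod (power_chart a)) (fun y => power_gram a y u v).
Proof.
move=> k; apply: (@Ck_sum_row _ _ _ _ (fun i => ccod (chart_of (a i)))
  (fun i z => gram (a i) z (row i u) (row i v))) => i; first exact: ccod_open.
exact: gram_smooth.
Qed.

Lemma power_gram_compat a b x :
  cdom (power_chart a) x -> cdom (power_chart b) x ->
  forall u v,
    let D := 'd (cmap (power_chart b) \o cinv (power_chart a))
                (cmap (power_chart a) x) in
    power_gram a (cmap (power_chart a) x) u v =
    power_gram b (cmap (power_chart b) x) (D u) (D v).
Proof.
move=> ax bx u v D; rewrite {}/D /= power_transitionE.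
have dT i : differentiable (cmap (chart_of (b i)) \o cinv (chart_of (a i)))
    (row i (power_map a x)).
  apply: (transition_smooth (a i) (b i) 1).1; exists (x i) => //.
  by rewrite row_power_map.
have DT := is_diff_blk dT.
rewrite !diff_val; apply: eq_bigr => i _; rewrite !row_blk !row_power_map.
exact: gram_compat.
Qed.

Definition power : riemannian 'M[R]_(n, d) :=
  Riemannian power_hausdorff power_second_countable power_chart_atP
    power_transition_smooth power_gram_sym power_gram_linear power_gram_posdef
    power_gram_smooth power_gram_compat.

End power.

Section Riemannian_geometry.
Context {R : realType} {E : normedModType R} {M : riemannian E}.
Implicit Types (p q x y : M) (a : atlas M) (I : set R) (U : set M).

Definition coord p : M -> E := cmap (chart_of (chart_at p)).

Definition tangent p : normedModType R := E.

Definition metric p (u v : tangent p) : R := gram (chart_at p) (coord p p) u v.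

Definition velocity (c : R -> M) (t : R) : tangent (c t) :=
  derive1 (coord (c t) \o c) t.

(* Christoffel symbols of the first kind: g(nabla_u v, w) for vector fields
   with constant coordinates u, v, w in the chart a *)
Definition christoffel1 a (y u v w : E) : R :=
  2^-1 * ('D_u (fun z => gram a z v w) y + 'D_v (fun z => gram a z u w) y
          - 'D_w (fun z => gram a z u v) y).

(* The vector representing the linear form l with respect to the inner product
   B; the default value 0 is never used when B is an inner product on a
   finite-dimensional space. *)
Definition sharp (B : E -> E -> R) (l : E -> R) : E :=
  xget 0 [set u | forall w, B u w = l w].

Definition christoffel a (y u v : E) : E :=
  sharp (gram a y) (christoffel1 a y u v).

Definition geodesic_on I (c : R -> M) : Prop :=
  forall t, I t -> {for t, continuous c} /\
    forall a, cdom (chart_of a) (c t) ->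
      let z := cmap (chart_of a) \o c in
      [/\ derivable z t 1, derivable (derive1 z) t 1 &
          derive1 (derive1 z) t +
            christoffel a (z t) (derive1 z t) (derive1 z t) = 0].

Definition C1_on I (c : R -> M) : Prop :=
  forall t, I t -> {for t, continuous c} /\
    forall a, cdom (chart_of a) (c t) ->
      let z := cmap (chart_of a) \o c in
      derivable z t 1 /\ {for t, continuous (derive1 z)}.

(* A property of parametrized curves on an open interval, for curves
   parametrized by [0, 1]: the values outside a neighborhood of [0, 1] are
   irrelevant. *)
Definition near01 (P : set R -> (R -> M) -> Prop) (c : R -> M) : Prop :=
  exists2 e : R, 0 < e & P `](- e), (1 + e)[%classic c.

Definition geodesic (c : R -> M) : Prop := near01 geodesic_on c.

Definition joins U p q (c : R -> M) : Prop :=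
  [/\ c 0 = p, c 1 = q & forall t, 0 <= t <= 1 -> U (c t)].

Definition curve_length (c : R -> M) : \bar R :=
  (\int[lebesgue_measure]_(t in `[0%R, 1%R]%classic)
     (Num.sqrt (metric (velocity c t) (velocity c t)))%:E)%E.

Definition Exp_graph p (v : tangent p) : set M :=
  [set q | exists c : R -> M,
     [/\ geodesic c, c 0 = p, velocity c 0 = v & c 1 = q]].

Definition Exp_dom p : set (tangent p) := [set v | Exp_graph v !=set0].

Definition Exp p (v : tangent p) : M := xget p (Exp_graph v).

(* The logarithm depends on the neighborhood U in which geodesics are taken. *)
Definition Log U p q : tangent p :=
  xget (0 : E) [set v : E | exists c : R -> M,
     [/\ geodesic c, joins U p q c & velocity c 0 = v]].

Definition smooth_into (V : set E) (F : E -> M) : Prop :=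
  (forall v, V v -> {for v, continuous F}) /\
  forall a, smooth_on (V `&` F @^-1` cdom (chart_of a))
                      (cmap (chart_of a) \o F).

Definition smooth_from U (W : normedModType R) (F : M -> W) : Prop :=
  forall a, smooth_on (cmap (chart_of a) @` (U `&` cdom (chart_of a)))
                      (F \o cinv (chart_of a)).

(* U is the diffeomorphic image under Exp of a star-shaped open set of T_pM *)
Definition normal_neighborhood p U : Prop :=
  exists (V : set (tangent p)) (L : M -> tangent p),
  [/\ [/\ open V, V 0, (forall v t, V v -> 0 <= t <= 1 -> V (t *: v)) &
          V `<=` @Exp_dom p],
      (forall v, V v -> U (Exp v) /\ L (Exp v) = v),
      (forall q, U q -> V (L q) /\ Exp (L q) = q),
      smooth_into V (@Exp p) & smooth_from U L].

Definition normal_convex U : Prop :=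
  [/\ open U,
      (forall p, U p -> normal_neighborhood p U) &
      forall p q, U p -> U q -> exists2 c : R -> M,
        geodesic c /\ joins U p q c &
        (forall c', geodesic c' -> joins U p q c' ->
           forall t, 0 <= t <= 1 -> c' t = c t) /\
        (forall c', near01 C1_on c' -> joins U p q c' ->
           (curve_length c <= curve_length c')%E)].

(* Differential at x of a map into a normed space, whose tangent spaces are
   identified with the space itself. *)
Definition differentiable_vec (W : normedModType R) (F : M -> W) x : Prop :=
  differentiable (F \o cinv (chart_of (chart_at x))) (coord x x).

Definition diff_vec (W : normedModType R) (F : M -> W) x : tangent x -> W :=
  'd (F \o cinv (chart_of (chart_at x))) (coord x x).

Definition differentiable_map (F : M -> M) x : Prop :=
  {for x, continuous F} /\ differentiable_vec (coord (F x) \o F) x.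

Definition diff_map (F : M -> M) x : tangent x -> tangent (F x) :=
  @diff_vec E (coord (F x) \o F) x.

Definition adjoint x y (F : tangent x -> tangent y) (w : tangent y) : tangent x :=
  sharp (@metric x) (fun v => metric (F v) w).

Definition grad (f : M -> R) x : tangent x :=
  sharp (@metric x) (@diff_vec R f x).

End Riemannian_geometry.

Definition power_set (R : realType) (d : nat) (M : riemannian 'rV[R]_d)
    (U : set M) (n : nat) : set (power M n) := [set x | forall i, U (x i)].

Arguments power_set {R d M} U n _.
Arguments diff_vec {R E M W} F x _.
Arguments diff_map {R E M} F x _.

(* Main.v *)
Require Import Defs.
From HB Require Import structures.
From mathcomp Require Import ring lra.

(** The first formula is the chain rule: f is the quadratic form of S composed
    with the logarithm at mu, and S is self-adjoint. For the second one, k is the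
    composite of Log, W and Exp, hence
      g (d k v, Log mu) = - g (dExp (W dLog v), c'(1))       at k x,
    where c is the geodesic t |-> Exp (t W Log x) from mu to k x, because the
    geodesic from k x to mu is c reversed. The Gauss lemma turns the right-hand
    side into - g (W dLog v, W Log x) = - g (dLog v, S Log x) at mu, and the
    first formula applies (gradient_squared_norm_log).

    The Gauss lemma is proved on the metric pulled back to the tangent space by
    Exp. Differentiating the product of the velocity of the ray of v with the
    variation t n, the geodesic equation and the symmetry of second derivatives
    (schwarz_mx) express the derivative by the first variation of the squared
    speed (dpull_radial), and the speed of each ray is constant
    (gpull_transverse, gpull_radial).

    All of this rests on the fact that t |-> Exp (t v) is the geodesic of
    initial velocity v, hence on the uniqueness of geodesics with given initial
    data. Locally, the difference of two solutions of the geodesic equation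
    satisfies a linear second-order inequality (solves_unique,
    second_order_zero); connectedness of [0, 1] gives the global statement
    (geodesic_on_unique). It follows that Log is the smooth inverse of Exp
    (LogE), and that the geodesic joining two points can be reversed (Log_back).

    These results are proved on manifolds modelled on a space of matrices, which
    covers both M, modelled on row vectors, and its power. A curve in the power
    is a geodesic exactly when its components are, so the power of U inherits the
    properties of U that are used (power_unique_joins,
    power_normal_neighborhood). *)

Set Implicit Arguments.
Unset Strict Implicit.
Unset Printing Implicit Defensive.

Import Order.TTheory GRing.Theory Num.Theory.
Import numFieldNormedType.Exports.

Local Open Scope classical_set_scope.
Local Open Scope ring_scope.

(** * Calculus in normed spaces *)

Section calculus.
Context {R : realType}.

Lemma is_derive_comp (V W : normedModType R) (z : R -> V) (H : V -> W) (t : R) (dz : V) :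
  is_derive t 1 z dz -> differentiable H (z t) ->
  is_derive t 1 (fun s => H (z s)) ('D_dz H (z t)).
Proof.
move=> [zd <-] dH; have /derivable1_diffP dz' := zd.
have dHz : differentiable (H \o z) t by exact: differentiable_comp.
apply: DeriveDef; first exact/derivable1_diffP.
by rewrite (deriveE _ dHz) diff_comp //= -!deriveE.
Qed.

Lemma derive_comp (U V W : normedModType R) (f : U -> V) (g : V -> W) x v :
  differentiable f x -> differentiable g (f x) ->
  'D_v (g \o f) x = 'D_('D_v f x) g (f x).
Proof.
move=> df dg; rewrite deriveE; last exact: differentiable_comp.
by rewrite diff_comp //= -!deriveE.
Qed.

Lemma is_derive_bigsum (I : finType) (V W : normedModType R) (f : I -> V -> W) df t v :
  (forall i, is_derive t v (f i) (df i)) ->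
  is_derive t v (fun s => \sum_i f i s) (\sum_i df i).
Proof.
move=> H; have -> : (fun s => \sum_i f i s) = \sum_i f i.
  by apply/funext => s; rewrite fct_sumE.
elim/big_ind2 : _; [exact: is_derive_cst|by move=> *; exact: is_deriveD|by move=> i _; exact: H].
Qed.

Lemma continuous_bigsum (I : finType) (V : topologicalType) (W : normedModType R)
  (f : I -> V -> W) t :
  (forall i, {for t, continuous (f i)}) ->
  {for t, continuous (fun s => \sum_i f i s)}.
Proof.
move=> H; have -> : (fun s => \sum_i f i s) = \sum_i f i.
  by apply/funext => s; rewrite fct_sumE.
elim/big_ind : _; [exact: cst_continuous|by move=> *; exact: continuousD|by move=> i _; exact: H].
Qed.

Lemma is_derive_line (V : normedModType R) (x u : V) (t : R) :
  is_derive t 1 (fun s => x + s *: u) u.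
Proof.
have d : is_derive t 1 (fun s : R => s *: u) u.
  have dd : is_diff t ( *:%R ^~ u) ( *:%R ^~ u) by exact: is_diff_scalel.
  apply: DeriveDef; first exact/diff_derivable/ex_diff.
  by rewrite deriveE; [rewrite diff_val scale1r | exact: ex_diff].
by have := is_deriveD (is_derive_cst x t 1) d; rewrite add0r.
Qed.

Lemma MVT_closed (f df : R -> R) (a b : R) : a <= b ->
  (forall x : R, a <= x <= b -> is_derive x 1 f (df x)) ->
  exists2 c, a <= c <= b & f b - f a = df c * (b - a).
Proof.
move=> ab H.
have [||c] := @MVT_segment _ f df a b ab; last by rewrite in_itv /= => ?; exists c.
  by move=> x; rewrite in_itv /= => /andP[? ?]; apply: H; rewrite !ltW.
apply: derivable_within_continuous => x; rewrite in_itv /= => ?.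
by have [] := H x.
Qed.

(** Two applications of the mean value theorem, first in the direction u, then
    in the direction v. *)
Lemma second_difference (V : normedModType R) (O : set V) (f : V -> R) (x u v : V) (s t : R) :
  Ck 2 O f -> 0 <= s -> 0 <= t ->
  (forall r q, 0 <= r <= s -> 0 <= q <= t -> O (x + r *: u + q *: v)) ->
  exists r q, [/\ 0 <= r <= s, 0 <= q <= t &
    f (x + s *: u + t *: v) - f (x + s *: u) - f (x + t *: v) + f x =
    'D_v (fun y => 'D_u f y) (x + r *: u + q *: v) * t * s].
Proof.
move=> [dfO CfO] s0 t0 inO.
have inO' r : 0 <= r <= s -> O (x + r *: u).
  by move=> rs; have := inO r 0 rs; rewrite scale0r addr0; apply; rewrite lexx.
have [r rs E] : exists2 r, 0 <= r <= s &
    f (x + s *: u + t *: v) - f (x + s *: u) - (f (x + t *: v) - f x) =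
    ('D_u f (x + r *: u + t *: v) - 'D_u f (x + r *: u)) * s.
  pose phi r := f (x + t *: v + r *: u) - f (x + r *: u).
  pose dphi r := 'D_u f (x + t *: v + r *: u) - 'D_u f (x + r *: u).
  have [|r rs] := @MVT_closed phi dphi 0 s s0.
    move=> r rs; apply: is_deriveB.
      apply: is_derive_comp; first exact: is_derive_line.
      by apply: dfO; rewrite addrAC; apply: inO; rewrite ?lexx ?t0.
    apply: is_derive_comp; first exact: is_derive_line.
    by apply: dfO; exact: inO'.
  rewrite /phi /dphi !scale0r !addr0 subr0 => E; exists r => //.
  by rewrite (addrAC x (s *: u)) E (addrAC x (t *: v)).
have [|q qt E'] := @MVT_closed (fun q => 'D_u f (x + r *: u + q *: v))
   (fun q => 'D_v (fun y => 'D_u f y) (x + r *: u + q *: v)) 0 t t0.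
  move=> q qt; apply: (is_derive_comp (H := fun y => 'D_u f y)).
    exact: is_derive_line.
  by apply: (CfO u).1; exact: inO.
exists r, q; split=> //.
rewrite scale0r addr0 subr0 in E'.
by rewrite -E' -E opprB addrA addrAC.
Qed.

Lemma eq_of_close_values (V : normedModType R) (F G : V -> R) (x : V) :
  {for x, continuous F} -> {for x, continuous G} ->
  (forall r : R, 0 < r -> exists y z, [/\ ball x r y, ball x r z & F y = G z]) ->
  F x = G x.
Proof.
move=> cF cG H; apply/eqP; rewrite -subr_eq0 -normr_le0.
apply/ler_addgt0Pr => e e0; rewrite add0r.
have e2 : 0 < e / 2 by rewrite divr_gt0.
have nF : nbhs x [set y | `|F x - F y| < e / 2] by have /cvgrPdist_lt := cF; exact.
have nG : nbhs x [set y | `|G x - G y| < e / 2] by have /cvgrPdist_lt := cG; exact.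
have /nbhs_ballP [r /= r0 Hr] :
    nbhs x ([set y | `|F x - F y| < e / 2] `&` [set y | `|G x - G y| < e / 2]).
  exact: filterI.
have [y [z [xy xz E]]] := H r r0.
have [/= h1 _] := Hr _ xy; have [/= _ h2] := Hr _ xz.
rewrite (splitr e) -(subrKA (F y)) (le_trans (ler_normD _ _)) // lerD ?ltW //.
by rewrite E distrC.
Qed.

(** Both orders of differentiation are limits of the same second difference
    quotient. *)
Lemma schwarz (V : normedModType R) (O : set V) (f : V -> R) x u v :
  open O -> Ck 2 O f -> O x ->
  'D_u (fun y => 'D_v f y) x = 'D_v (fun y => 'D_u f y) x.
Proof.
move=> oO C2 Ox; have cF : {for x, continuous ('D_u (fun y => 'D_v f y))} by exact: (C2.2 v).2.
have cG : {for x, continuous ('D_v (fun y => 'D_u f y))} by exact: (C2.2 u).2.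
apply: (eq_of_close_values cF cG) => r r0.
have /nbhs_ballP [r1 /= r10 Hr1] : nbhs x O by exact: open_nbhs_nbhs.
pose s := Num.min r r1 / (`|u| + `|v| + 1).
have uv0 : 0 < `|u| + `|v| + 1 by rewrite ltr_wpDl // addr_ge0.
have m0 : 0 < Num.min r r1 by rewrite lt_min r0.
have s0 : 0 < s by rewrite divr_gt0.
have inB p q : 0 <= p <= s -> 0 <= q <= s ->
    ball x r (x + p *: u + q *: v) /\ O (x + p *: u + q *: v).
  move=> /andP[p0 ps] /andP[q0 qs].
  have H : ball x (Num.min r r1) (x + p *: u + q *: v).
    rewrite -ball_normE /ball_ /= opprD opprD !addrA subrr sub0r.
    rewrite -opprD normrN (le_lt_trans (ler_normD _ _)) //.
    rewrite !normrZ (ger0_norm p0) (ger0_norm q0).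
    apply: (@le_lt_trans _ _ (s * (`|u| + `|v|))).
      by rewrite mulrDr lerD // ler_wpM2r.
    by rewrite /s mulrAC ltr_pdivrMr // ltr_pM2l // ltrDl.
  split; last by apply: Hr1; apply: le_ball H; rewrite ge_min lexx orbT.
  by apply: le_ball H; rewrite ge_min lexx.
have inB' p q : 0 <= p <= s -> 0 <= q <= s ->
    ball x r (x + p *: v + q *: u) /\ O (x + p *: v + q *: u).
  by move=> ps qs; rewrite addrAC; exact: inB.
have [|p [q [ps qs E1]]] := @second_difference V O f x u v s s C2 (ltW s0) (ltW s0).
  by move=> p q ps qs; exact: (inB _ _ ps qs).2.
have [|p' [q' [ps' qs' E2]]] := @second_difference V O f x v u s s C2 (ltW s0) (ltW s0).
  by move=> a b aS bS; exact: (inB' _ _ aS bS).2.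
exists (x + p' *: v + q' *: u), (x + p *: u + q *: v); split.
- exact: (inB' _ _ ps' qs').1.
- exact: (inB _ _ ps qs).1.
have sn0 : s != 0 by rewrite gt_eqF.
move: E1 E2; move: ('D_v _ (_ + _)) ('D_u _ (_ + _)) => X Y E1 E2.
apply: (mulIf sn0); apply: (mulIf sn0); rewrite -E1 -E2.
rewrite (addrAC x (s *: v) (s *: u)); congr (_ + _).
exact: addrAC.
Qed.

End calculus.

(** * Matrix spaces in coordinates *)

Section matrix_space.
Context {R : realType} {m d : nat}.
Notation E := 'M[R]_(m, d).
Notation Ix := ('I_m * 'I_d)%type.

Definition elem (K : Ix) : E := delta_mx K.1 K.2.
Definition entry (u : E) (K : Ix) : R := u K.1 K.2.

Lemma sum_entries (u : E) : u = \sum_K entry u K *: elem K.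
Proof.
by rewrite {1}[u]matrix_sum_delta pair_bigA.
Qed.

Lemma linear_entries (V : lmodType R) (L : {linear E -> V}) u :
  L u = \sum_K entry u K *: L (elem K).
Proof. by rewrite {1}[u]sum_entries linear_sum; apply: eq_bigr => K _; rewrite linearZ. Qed.

Lemma entry_linear K : linear (entry ^~ K).
Proof. by move=> k u v; rewrite /entry !mxE. Qed.

Lemma entry_continuous K : continuous (entry ^~ K).
Proof. exact: coord_continuous. Qed.

Lemma differentiable_entry K (u : E) : differentiable (entry ^~ K) u.
Proof. exact: differentiable_coord. Qed.

Lemma linear_mx_continuous (V : normedModType R) (L : {linear E -> V}) : continuous L.
Proof.
move=> u; have -> : (L : E -> V) = fun u => \sum_K entry u K *: L (elem K).
  by apply/funext => v; exact: linear_entries.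
apply: continuous_bigsum => K.
by apply: continuousZr_tmp; exact: entry_continuous.
Qed.

Lemma linear_mx_differentiable (V : normedModType R) (L : {linear E -> V}) u : differentiable L u.
Proof. exact/linear_differentiable/linear_mx_continuous. Qed.

Lemma derive_linear_mx (V : normedModType R) (L : {linear E -> V}) u v : 'D_v L u = L v.
Proof.
rewrite deriveE; last exact: linear_mx_differentiable.
by rewrite diff_lin //; exact: linear_mx_continuous.
Qed.

Lemma mx_norm_leP (u : E) (B : R) : 0 <= B -> (forall K, `|entry u K| <= B) <-> `|u| <= B.
Proof.
move=> B0; split=> [H|uB K].
  rewrite [leLHS]/Num.Def.normr /= mx_normrE; apply: bigmax_le => // K _; exact: H.
apply: le_trans uB; rewrite [leRHS]/Num.Def.normr /= mx_normrE.
exact: (le_bigmax _ (fun ij : Ix => `|u ij.1 ij.2|) K).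
Qed.

Lemma entry_le (u : E) K : `|entry u K| <= `|u|.
Proof. by move: K; apply/mx_norm_leP. Qed.

Lemma is_derive_entry (V : normedModType R) (z : V -> E) t v dz K :
  is_derive t v z dz -> is_derive t v (fun s => entry (z s) K) (entry dz K).
Proof.
move=> [zd <-]; have /derivable_mxP H := zd.
apply: DeriveDef; first exact: H.
by rewrite derive_mx // /entry mxE.
Qed.

Lemma derive_sum_dir (V W : normedModType R) (I : finType) (f : V -> W) (x : V) (c : I -> R) (e : I -> V) :
  differentiable f x ->
  'D_(\sum_i c i *: e i) f x = \sum_i c i *: 'D_(e i) f x.
Proof.
move=> df; rewrite deriveE // linear_sum; apply: eq_bigr => i _.
by rewrite linearZ deriveE.
Qed.

Lemma derive_entries (W : normedModType R) (f : E -> W) x w : differentiable f x ->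
  'D_w f x = \sum_K entry w K *: 'D_(elem K) f x.
Proof. by move=> df; rewrite {1}(sum_entries w) derive_sum_dir. Qed.

Lemma deriveD_dir (V W : normedModType R) (f : V -> W) (x u v : V) k : differentiable f x ->
  'D_(k *: u + v) f x = k *: 'D_u f x + 'D_v f x.
Proof. by move=> df; rewrite !deriveE // linearP. Qed.

(** Along a segment in a ball, the increment of a C^1 function is controlled by
    its partial derivatives, which stay bounded near the centre by continuity. *)
Lemma C1_lipschitz (O : set E) (f : E -> R) y0 : open O -> Ck 1 O f -> O y0 ->
  exists (C : R) (r : R), 0 < r /\ forall y y', ball y0 r y -> ball y0 r y' ->
    `|f y - f y'| <= C * `|y - y'|.
Proof.
move=> oO [dfO cfO] Oy0.
have nO : nbhs y0 O by exact: open_nbhs_nbhs.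
pose B K := `|'D_(elem K) f y0| + 1.
have nB : nbhs y0 [set y | forall K, `|'D_(elem K) f y| <= B K].
  apply: (@filter_forall _ _ _ _ (nbhs_filter y0)) => K.
  have c : {for y0, continuous (fun y => 'D_(elem K) f y)} by exact: cfO.
  have /(_ _ (B K)) := cvgr_norm_lt _ c; rewrite /B ltrDl => /(_ ltr01).
  by apply: filterS => y /ltW.
have /nbhs_ballP [r /= r0 H] :
    nbhs y0 (O `&` [set y | forall K, `|'D_(elem K) f y| <= B K]) by exact: filterI.
exists (\sum_K B K), r; split=> // y y' yr y'r.
pose z s := y' + s *: (y - y').
have zball s : 0 <= s <= 1 -> ball y0 r (z s).
  move=> /andP[s0 s1]; move: yr y'r; rewrite -!ball_normE /ball_ /= => yr y'r.
  have -> : y0 - z s = s *: (y0 - y) + (1 - s) *: (y0 - y').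
    by apply/matrixP => i j; rewrite /z !mxE; ring.
  rewrite (le_lt_trans (ler_normD _ _)) // !normrZ (ger0_norm s0) ger0_norm ?subr_ge0 //.
  have [->|sn0] := eqVneq s 0; first by rewrite mul0r add0r subr0 mul1r.
  apply: (@lt_le_trans _ _ (s * r + (1 - s) * r)).
    apply: ltr_leD; first by rewrite ltr_pM2l // lt_neqAle eq_sym sn0.
    by rewrite ler_wpM2l ?subr_ge0 // ltW.
  by rewrite -mulrDl subrKC mul1r.
have [|c cs] := @MVT_closed _ (f \o z) (fun s => 'D_(y - y') f (z s)) 0 1 ler01.
  move=> s s01; apply: is_derive_comp; first exact: is_derive_line.
  by apply: dfO; exact: (H _ (zball _ s01)).1.
rewrite /= /z scale0r addr0 scale1r subrKC subr0 mulr1 => ->.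
rewrite derive_entries; last by apply: dfO; exact: (H _ (zball _ cs)).1.
rewrite (le_trans (ler_norm_sum _ _ _)) // mulr_suml ler_sum // => K _.
rewrite normrM mulrC ler_pM ?normr_ge0 //; last exact: entry_le.
exact: (H _ (zball _ cs)).2.
Qed.

Lemma norm_MVT (z dz : R -> E) (t0 r M : R) : 0 <= M ->
  (forall s : R, `|s - t0| <= r -> is_derive s 1 z (dz s) /\ `|dz s| <= M) ->
  forall t, `|t - t0| <= r -> `|z t - z t0| <= M * r.
Proof.
move=> M0 H t tr; have r0 : 0 <= r by apply: le_trans tr.
have step a b : a <= b -> `|a - t0| <= r -> `|b - t0| <= r ->
    forall K, `|entry (z b) K - entry (z a) K| <= M * (b - a).
  move=> ab ar br K.
  have inr s : a <= s <= b -> `|s - t0| <= r.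
    move: ar br; rewrite !ler_norml => /andP[? ?] /andP[? ?] /andP[? ?].
    by apply/andP; split; lra.
  have [|c cab ->] := @MVT_closed _ (fun s => entry (z s) K) (fun s => entry (dz s) K) a b ab.
    by move=> s sab; apply: is_derive_entry; exact: (H _ (inr _ sab)).1.
  rewrite normrM (@ger0_norm _ (b - a)) ?subr_ge0 //.
  rewrite ler_wpM2r ?subr_ge0 // (le_trans (entry_le _ _)) //.
  exact: (H _ (inr _ cab)).2.
have t0r : `|t0 - t0| <= r by rewrite subrr normr0.
apply/mx_norm_leP; first by rewrite mulr_ge0.
move=> K; have -> : entry (z t - z t0) K = entry (z t) K - entry (z t0) K by rewrite /entry !mxE.
have [tt0|/ltW tt0] := leP t0 t.
  apply: le_trans (step _ _ tt0 t0r tr K) _; rewrite ler_wpM2l //.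
  by rewrite (le_trans _ tr) // ler_norm.
rewrite distrC; apply: le_trans (step _ _ tt0 tr t0r K) _; rewrite ler_wpM2l //.
by rewrite (le_trans _ tr) // distrC ler_norm.
Qed.

(** On a short interval around t0 the maximum M of |dz| bounds |z|, hence |ddz|,
    hence |dz| again, with a total factor of at most 1/2; so M = 0. *)
Lemma second_order_zero (z dz ddz : R -> E) (t0 C : R) : z t0 = 0 -> dz t0 = 0 ->
  (\forall t \near (t0 : R), [/\ is_derive (t : R) 1 z (dz t), is_derive t 1 dz (ddz t) &
     `|ddz t| <= C * (`|z t| + `|dz t|)]) ->
  \forall t \near t0, z t = 0.
Proof.
move=> zt0 dzt0 /nbhs_ballP [r0 /= r00 H].
pose C1 := `|C| + 1.
have C10 : 0 < C1 by rewrite ltr_wpDl.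
(* r is chosen so that the bound of the derivative on the interval of radius r
   comes out as half of its maximum M *)
pose r := Num.min (r0 / 2) (Num.min 1 (C1^-1 / 4)).
have r_gt0 : 0 < r by rewrite !lt_min ?divr_gt0 ?invr_gt0 // ltr01.
have r1 : r <= 1 by rewrite !ge_min lexx /= orbT.
have rr0 : r < r0 by rewrite gt_min ltr_pdivrMr // mulr2n mulrDr mulr1 ltrDl r00.
have rC : C1 * (2 * r) <= 2^-1.
  have : r <= C1^-1 / 4 by rewrite !ge_min lexx !orbT.
  rewrite -(ler_pM2l C10) mulrA divff ?gt_eqF //; lra.
have inH t : `|t - t0| <= r -> [/\ is_derive t 1 z (dz t), is_derive t 1 dz (ddz t) &
     `|ddz t| <= C * (`|z t| + `|dz t|)].
  move=> tr; apply: H; rewrite -ball_normE /ball_ /= distrC.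
  exact: le_lt_trans rr0.
have ab : t0 - r <= t0 + r by lra.
have inI t : t \in `[t0 - r, t0 + r] = (`|t - t0| <= r).
  by rewrite in_itv /= ler_distl.
have [|c] := @EVT_max _ (fun t => `|dz t|) _ _ ab.
  apply/continuous_in_subspaceT => t; rewrite inE /= inI => tr.
  have [_ [ddt _] _] := inH t tr.
  apply: continuous_comp; last exact: norm_continuous.
  by apply/differentiable_continuous/derivable1_diffP.
rewrite inI => cr max; pose M := `|dz c|.
have M0 : 0 <= M by exact: normr_ge0.
have M1 : 0 <= C1 * (2 * M) by apply: mulr_ge0; [exact: ltW|apply: mulr_ge0].
have zM t : `|t - t0| <= r -> `|z t| <= M * r.
  move=> tr; rewrite -[z t]subr0 -zt0; apply: (norm_MVT (dz := dz) M0) => // s sr.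
  by have [? _ _] := inH s sr; split=> //; apply: max; rewrite inI.
have ddzM t : `|t - t0| <= r -> `|ddz t| <= C1 * (2 * M).
  move=> tr; have [_ _ /le_trans] := inH t tr; apply.
  apply: (@le_trans _ _ (C1 * (`|z t| + `|dz t|))).
    by rewrite ler_wpM2r ?addr_ge0 // (le_trans (ler_norm C)) // lerDl.
  rewrite ler_pM2l // mulr2n mulrDl mul1r lerD //.
    by rewrite (le_trans (zM _ tr)) // ler_piMr.
  by apply: max; rewrite inI.
have : M <= C1 * (2 * M) * r.
  rewrite {1}/M -[dz c]subr0 -dzt0; apply: (norm_MVT (dz := ddz) M1) => //.
  by move=> s sr; have [_ ? _] := inH s sr; split=> //; exact: ddzM.
have -> : C1 * (2 * M) * r = C1 * (2 * r) * M by ring.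
move=> /le_trans /(_ (ler_wpM2r M0 rC)) M2.
have ME : M = 0 by lra.
apply/nbhs_ballP; exists r => // t; rewrite -ball_normE /ball_ /= distrC => tr.
by apply/eqP; rewrite -normr_le0 (le_trans (zM _ (ltW tr))) // ME mul0r.
Qed.

End matrix_space.

(** * Inner products, and domination near a point *)

Section inner_products.
Context {R : realType} {m d : nat}.
Notation E := 'M[R]_(m, d).

Definition inner_product (B : E -> E -> R) : Prop :=
  [/\ forall u v, B u v = B v u,
      forall u k v w, B u (k *: v + w) = k * B u v + B u w &
      forall u, u != 0 -> 0 < B u u].

Context (B : E -> E -> R).
Context (iB : inner_product B).

Lemma innerC u v : B u v = B v u. Proof. by case: iB. Qed.

Lemma inner_linear u : linear (B u : E -> R^o).
Proof. by case: iB => _ H _ k v w; exact: H. Qed.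

Lemma inner0r u : B u 0 = 0.
Proof.
have := inner_linear u (-1) 0 0; rewrite scaleN1r addr0 oppr0 => ->.
by rewrite scaleN1r addNr.
Qed.

Lemma innerZr u k v : B u (k *: v) = k * B u v.
Proof. by have := inner_linear u k v 0; rewrite !addr0 inner0r addr0. Qed.

Lemma innerDr u v w : B u (v + w) = B u v + B u w.
Proof. by have := inner_linear u 1 v w; rewrite !scale1r. Qed.

Lemma innerDl u v w : B (u + v) w = B u w + B v w.
Proof. by rewrite innerC innerDr !(innerC w). Qed.

Lemma innerZl k u v : B (k *: u) v = k * B u v.
Proof. by rewrite innerC innerZr innerC. Qed.

Lemma innerNr u v : B u (- v) = - B u v.
Proof. by rewrite -scaleN1r innerZr mulN1r. Qed.

Lemma innerNl u v : B (- u) v = - B u v.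
Proof. by rewrite -scaleN1r innerZl mulN1r. Qed.

Lemma innerBl u v w : B (u - v) w = B u w - B v w.
Proof. by rewrite innerDl innerNl. Qed.

Lemma inner_entryr u v : B u v = \sum_K entry v K * B u (elem K).
Proof.
pose L : {linear E -> R^o} := HB.pack (B u : E -> R^o)
  (GRing.isLinear.Build R E R^o *:%R (B u : E -> R^o) (inner_linear u)).
exact: (linear_entries L v).
Qed.

Lemma inner_entryl u v : B u v = \sum_K entry u K * B (elem K) v.
Proof. by rewrite innerC inner_entryr; apply: eq_bigr => K _; rewrite innerC. Qed.

Lemma inner_entry u v : B u v = \sum_K \sum_J entry u K * (entry v J * B (elem K) (elem J)).
Proof.
rewrite inner_entryl; apply: eq_bigr => K _; rewrite inner_entryr mulr_sumr.
by [].
Qed.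

Lemma inner_inj u v : (forall w, B u w = B v w) -> u = v.
Proof.
move=> H; apply/eqP; rewrite -subr_eq0; apply/negPn/negP => uv0.
case: iB => _ _ /(_ _ uv0).
by rewrite innerDl innerNl H subrr ltxx.
Qed.

(** Riesz: the map sending a vector to the values of its scalar products with
    the canonical basis is injective, hence onto. *)
Lemma riesz (l : E -> R) : linear (l : E -> R^o) -> exists u, forall w, B u w = l w.
Proof.
move=> ll.
pose T (u : E) : E := \matrix_(i, j) B u (elem (i, j)).
have lT : linear T.
  by move=> k u v; apply/matrixP => i j; rewrite !mxE innerDl innerZl.
pose TL : {linear E -> E} := HB.pack T (GRing.isLinear.Build R E E _ T lT).
have TE u : linfun TL u = T u by rewrite lfunE.
have kT : lker (linfun TL) == 0%VS.
  apply/lker0P => u v; rewrite !TE => Tuv; apply: inner_inj => w.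
  rewrite !(inner_entryr _ w); apply: eq_bigr => -[i j] _; congr (_ * _).
  by have /matrixP/(_ i j) := Tuv; rewrite !mxE.
pose lL : {linear E -> R^o} := HB.pack (l : E -> R^o)
  (GRing.isLinear.Build R E R^o *:%R (l : E -> R^o) ll).
exists ((linfun TL)^-1%VF (\matrix_(i, j) l (elem (i, j)))) => w.
rewrite inner_entryr [RHS](linear_entries lL w); apply: eq_bigr => -[i j] _.
congr (_ * _).
have := lker0_lfunVK kT (\matrix_(i, j) l (elem (i, j))).
by move=> /matrixP/(_ i j); rewrite TE !mxE.
Qed.

Lemma sharpP (l : E -> R) : linear (l : E -> R^o) -> forall w, B (sharp B l) w = l w.
Proof.
move=> /riesz [u Hu]; rewrite /sharp.
by case: xgetP => [v _ //|/(_ u)]; case.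
Qed.

Lemma sharp_eq (l : E -> R) u : (forall w, B u w = l w) -> sharp B l = u.
Proof.
move=> H; rewrite /sharp; case: xgetP => [v _ vl|/(_ u)]; last by case.
by apply: inner_inj => w; rewrite vl H.
Qed.

End inner_products.

Section dominated.
Context {R : realType} (t0 : R).
Implicit Types (e X Y : R -> R).

(** Domination near t0, of which local boundedness is the case e = 1. *)
Definition dominated e X := exists C, \forall t \near t0, `|X t| <= C * e t.

Lemma dominated_bound e X Y : dominated e Y -> (\forall t \near t0, `|X t| <= Y t) -> dominated e X.
Proof.
move=> [C HC] H; exists C; apply: filterS2 HC H => t h1 h2.
by rewrite (le_trans h2) // (le_trans _ h1) // ler_norm.
Qed.

Lemma dominated_ext e X Y : dominated e Y -> (\forall t \near t0, X t = Y t) -> dominated e X.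
Proof. by move=> [C HC] H; exists C; apply: filterS2 HC H => t h1 ->. Qed.

Lemma dominatedD e X Y : dominated e X -> dominated e Y -> dominated e (fun t => X t + Y t).
Proof.
move=> [C HC] [D HD]; exists (C + D); apply: filterS2 HC HD => t h1 h2.
by rewrite (le_trans (ler_normD _ _)) // mulrDl lerD.
Qed.

Lemma dominatedM e X Y : dominated e X -> dominated (fun=> 1) Y -> dominated e (fun t => X t * Y t).
Proof.
move=> [C HC] [D HD]; exists (C * D); apply: filterS2 HC HD => t h1 h2.
by rewrite mulr1 in h2; rewrite normrM mulrAC ler_pM.
Qed.

Lemma dominated_sum e (I : finType) (X : I -> R -> R) : (forall i, dominated e (X i)) ->
  dominated e (fun t => \sum_i X i t).
Proof.
move=> H; have [C HC] := choice H.
exists (\sum_i C i).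
have : nbhs t0 [set t | forall i, `|X i t| <= C i * e t].
  by apply: (@filter_forall _ _ _ _ (nbhs_filter t0)) => i; exact: HC.
apply: filterS => t Ht.
by rewrite (le_trans (ler_norm_sum _ _ _)) // mulr_suml ler_sum.
Qed.

Lemma dominated_diffM e X X' Y Y' :
  dominated e (fun t => X t - X' t) -> dominated e (fun t => Y t - Y' t) ->
  dominated (fun=> 1) Y -> dominated (fun=> 1) X' ->
  dominated e (fun t => X t * Y t - X' t * Y' t).
Proof.
move=> dX dY bY bX'; apply: (dominated_ext (dominatedD (dominatedM dX bY) (dominatedM dY bX'))).
by apply: (@nearW _ (nbhs t0)) => t; ring.
Qed.

Lemma dominated_cont X : {for t0, continuous X} -> dominated (fun=> 1) X.
Proof.
move=> cX; exists (`|X t0| + 1).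
have X1 : `|X t0| < `|X t0| + 1 by rewrite ltrDl.
have H : \forall t \near t0, `|X t| < `|X t0| + 1 by exact: cvgr_norm_lt cX _ X1.
by apply: filterS H => t /ltW; rewrite mulr1.
Qed.

End dominated.

(** * The metric and the Christoffel symbols in a chart *)

Section chart_geometry.
Context {R : realType} {m d : nat} {N : riemannian 'M[R]_(m, d)}.
Notation E := 'M[R]_(m, d).
Context (a : atlas N).
Notation O := (ccod (chart_of a)).
Implicit Types (y u v w : E).

Lemma gram_inner y : O y -> inner_product (gram a y).
Proof.
move=> Oy; split=> [u v|u k v w|u]; first exact: gram_sym.
  exact: gram_linear.
exact: gram_posdef.
Qed.

Lemma near_ccod y : O y -> nbhs y O.
Proof. by move=> Oy; apply: open_nbhs_nbhs; split=> //; exact: ccod_open. Qed.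

Lemma gram_diff y u v : O y -> differentiable (fun z => gram a z u v) y.
Proof. by move=> Oy; apply: (gram_smooth a u v 1).1. Qed.

Lemma dgram_entry y u v w : O y -> 'D_w (fun z => gram a z u v) y =
  \sum_K \sum_J entry u K * (entry v J * 'D_w (fun z => gram a z (elem K) (elem J)) y).
Proof.
move=> Oy.
have E1 : \forall z \near y, gram a z u v =
    \sum_K \sum_J entry u K * (entry v J * gram a z (elem K) (elem J)).
  by apply: filterS (near_ccod Oy) => z Oz; exact: inner_entry (gram_inner Oz) _ _.
rewrite (near_eq_derive w E1).
have D : is_derive y w (fun z => \sum_K \sum_J entry u K * (entry v J * gram a z (elem K) (elem J)))
  (\sum_K \sum_J entry u K * (entry v J * 'D_w (fun z => gram a z (elem K) (elem J)) y)).
  apply: is_derive_bigsum => K; apply: is_derive_bigsum => J.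
  apply: (is_deriveZ (f := fun z => entry v J * gram a z (elem K) (elem J))).
  apply: (is_deriveZ (f := fun z => gram a z (elem K) (elem J))).
  by apply: derivableP; apply: diff_derivable; exact: gram_diff.
exact: derive_val.
Qed.

Lemma is_derive_gram (z A B : R -> E) (t : R) dz dA dB : O (z t) ->
  is_derive t 1 z dz -> is_derive t 1 A dA -> is_derive t 1 B dB ->
  is_derive t 1 (fun s => gram a (z s) (A s) (B s))
    ('D_dz (fun y => gram a y (A t) (B t)) (z t)
      + gram a (z t) dA (B t) + gram a (z t) (A t) dB).
Proof.
move=> Oz zd Ad Bd.
have cz : {for t, continuous z} by apply/differentiable_continuous/derivable1_diffP.
have E1 : \forall s \near t,
    \sum_K \sum_J entry (A s) K * (entry (B s) J * gram a (z s) (elem K) (elem J)) =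
    gram a (z s) (A s) (B s).
  have H : \forall s \near t, O (z s) by apply: (cz _ (near_ccod Oz)).
  by apply: filterS H => s Os; rewrite -inner_entry //; exact: gram_inner.
apply: (near_eq_is_derive E1).
pose g K J s := gram a (z s) (elem K) (elem J).
pose dg K J := 'D_dz (fun y => gram a y (elem K) (elem J)) (z t).
have D : is_derive t 1 (fun s => \sum_K \sum_J entry (A s) K * (entry (B s) J * g K J s))
  (\sum_K \sum_J (entry (A t) K * (entry (B t) J * dg K J + g K J t * entry dB J)
     + entry (B t) J * g K J t * entry dA K)).
  apply: is_derive_bigsum => K; apply: is_derive_bigsum => J.
  apply: (is_deriveM (f := fun s => entry (A s) K) (g := fun s => entry (B s) J * g K J s)).
    exact: is_derive_entry.
  apply: (is_deriveM (f := fun s => entry (B s) J) (g := g K J)).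
    exact: is_derive_entry.
  by apply: is_derive_comp => //; exact: gram_diff.
refine (is_derive_eq D _).
rewrite dgram_entry // !(inner_entry (gram_inner Oz)) -!big_split /=.
apply: eq_bigr => K _; rewrite -!big_split /=; apply: eq_bigr => J _.
rewrite /g /dg; ring.
Qed.

Lemma christoffel1_linear y u v : O y -> linear (christoffel1 a y u v : E -> R^o).
Proof.
move=> Oy k w w'; rewrite /christoffel1.
have E1 p w0 : 'D_p (fun z => gram a z w0 (k *: w + w')) y =
    k * 'D_p (fun z => gram a z w0 w) y + 'D_p (fun z => gram a z w0 w') y.
  have E2 : \forall z \near y,
     gram a z w0 (k *: w + w') = k * gram a z w0 w + gram a z w0 w'.
    by apply: filterS (near_ccod Oy) => z Oz; exact: gram_linear.
  rewrite (near_eq_derive p E2).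
  have D : is_derive y p (fun z => k * gram a z w0 w + gram a z w0 w')
    (k * 'D_p (fun z => gram a z w0 w) y + 'D_p (fun z => gram a z w0 w') y).
    apply: (is_deriveD (f := fun z => k * gram a z w0 w)).
      apply: (is_deriveZ (f := fun z => gram a z w0 w)).
      by apply: derivableP; apply: diff_derivable; exact: gram_diff.
    by apply: derivableP; apply: diff_derivable; exact: gram_diff.
  exact: derive_val.
rewrite !E1 deriveD_dir; last exact: gram_diff.
rewrite /GRing.scale /=; ring.
Qed.

Lemma gram_christoffel y u v w : O y ->
  gram a y (christoffel a y u v) w = christoffel1 a y u v w.
Proof.
by move=> Oy; apply: sharpP; [exact: gram_inner|exact: christoffel1_linear].
Qed.

Lemma christoffel1_quad y u w : O y -> christoffel1 a y u u w =
  \sum_K \sum_J entry u K * (entry u J *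
    ('D_(elem K) (fun z => gram a z (elem J) w) y
      - 2^-1 * 'D_w (fun z => gram a z (elem K) (elem J)) y)).
Proof.
move=> Oy; have -> : christoffel1 a y u u w =
    'D_u (fun z => gram a z u w) y - 2^-1 * 'D_w (fun z => gram a z u u) y.
  by rewrite /christoffel1; field.
rewrite derive_entries; last exact: gram_diff.
rewrite (dgram_entry u u w Oy) mulr_sumr -sumrB; apply: eq_bigr => K _.
have -> : 'D_(elem K) (fun z => gram a z u w) y =
    \sum_J entry u J * 'D_(elem K) (fun z => gram a z (elem J) w) y.
  have E1 : \forall z \near y, gram a z u w = \sum_J entry u J * gram a z (elem J) w.
    by apply: filterS (near_ccod Oy) => z Oz; exact: inner_entryl (gram_inner Oz) _ _.
  rewrite (near_eq_derive _ E1).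
  have D : is_derive y (elem K) (fun z => \sum_J entry u J * gram a z (elem J) w)
    (\sum_J entry u J * 'D_(elem K) (fun z => gram a z (elem J) w) y).
    apply: is_derive_bigsum => J; apply: (is_deriveZ (f := fun z => gram a z (elem J) w)).
    by apply: derivableP; apply: diff_derivable; exact: gram_diff.
  exact: derive_val.
rewrite /GRing.scale /= !mulr_sumr -sumrB; apply: eq_bigr => J _; ring.
Qed.

Lemma christoffel_scale y k u : O y ->
  christoffel a y (k *: u) (k *: u) = k ^+ 2 *: christoffel a y u u.
Proof.
move=> Oy; have iG := gram_inner Oy.
apply: (inner_inj iG) => w; rewrite (innerZl iG) !gram_christoffel //.
rewrite !christoffel1_quad // mulr_sumr; apply: eq_bigr => K _.
rewrite mulr_sumr; apply: eq_bigr => J _.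
by rewrite /entry !mxE; ring.
Qed.

(** Writing the coordinates of u as scalar products with fixed vectors for the
    metric at y0, the error made by using the metric at y is absorbed in |u|
    for y close to y0. *)
Lemma gram_coercive y0 : O y0 -> exists C : R, 0 <= C /\ \forall y \near y0,
  forall u, `|u| <= C * \sum_J `|gram a y u (elem J)|.
Proof.
move=> Oy0; have iG := gram_inner Oy0.
have /choice [b Hb] : forall K, exists bK, forall u, gram a y0 bK u = entry u K.
  by move=> K; apply: (riesz iG (l := entry ^~ K)); exact: entry_linear.
pose h K y := \sum_I `|gram a y (elem I) (b K) - gram a y0 (elem I) (b K)|.
have nh : nbhs y0 [set y | forall K, h K y < 2^-1].
  apply: (@filter_forall _ _ _ _ (nbhs_filter y0)) => K.
  have ch : {for y0, continuous (h K)}.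
    apply: continuous_bigsum => I.
    apply: continuous_comp; last exact: norm_continuous.
    apply: continuousB; last exact: cst_continuous.
    exact/differentiable_continuous/gram_diff.
  have h0 : h K y0 = 0 by apply: big1 => I _; rewrite subrr normr0.
  have h2 : h K y0 < 2^-1 by rewrite h0 invr_gt0.
  exact: (cvgr_lt _ ch _ h2).
pose B := \sum_K `|b K|.
have B0 : 0 <= B by apply: sumr_ge0.
exists (2 * B); split; first exact: mulr_ge0.
have H : nbhs y0 (O `&` [set y | forall K, h K y < 2^-1]).
  by apply: filterI => //; exact: near_ccod.
apply: filterS H => y [Oy hy] u; have iGy := gram_inner Oy.
set S := \sum_J _; have S0 : 0 <= S by apply: sumr_ge0.
suff : `|u| <= B * S + 2^-1 * `|u| by lra.
apply/mx_norm_leP; first by rewrite addr_ge0 ?mulr_ge0 ?invr_ge0.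
move=> K; rewrite -Hb (innerC iG).
have -> : gram a y0 u (b K) = gram a y u (b K)
   - (gram a y u (b K) - gram a y0 u (b K)) by ring.
rewrite (le_trans (ler_normB _ _)) // lerD //.
  rewrite (inner_entryr iGy) (le_trans (ler_norm_sum _ _ _)) // mulr_sumr ler_sum // => J _.
  rewrite normrM ler_wpM2r // (le_trans (entry_le _ _)) //.
  by rewrite /B (bigD1 K) //= lerDl sumr_ge0.
rewrite (inner_entryl iGy) (inner_entryl iG) -sumrB (le_trans (ler_norm_sum _ _ _)) //.
apply: (@le_trans _ _ (h K y * `|u|)); last by rewrite ler_wpM2r // ltW.
rewrite /h mulr_suml ler_sum // => I _.
by rewrite -mulrBr normrM mulrC ler_wpM2l // entry_le.
Qed.

End chart_geometry.

(** * Local uniqueness of geodesics *)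

Section geodesic_uniqueness.
Context {R : realType} {m d : nat} {N : riemannian 'M[R]_(m, d)}.
Notation E := 'M[R]_(m, d).

Definition solves (a : atlas N) (z : R -> E) (t : R) : Prop :=
  [/\ ccod (chart_of a) (z t), derivable z t 1, derivable (derive1 z) t 1 &
    derive1 (derive1 z) t + christoffel a (z t) (derive1 z t) (derive1 z t) = 0].

Section local.
Context (a : atlas N) (z1 z2 : R -> E) (t0 : R).
Notation O := (ccod (chart_of a)).
Context (s1 : \forall t \near t0, solves a z1 t).
Context (s2 : \forall t \near t0, solves a z2 t).
Context (zE : z1 t0 = z2 t0).
Context (dzE : derive1 z1 t0 = derive1 z2 t0).

Let dlt t := z1 t - z2 t.
Let ddlt t := derive1 z1 t - derive1 z2 t.
Let e t := `|dlt t| + `|ddlt t|.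

Lemma derivable_cont (V : normedModType R) (z : R -> V) (t : R) : derivable z t 1 -> {for t, continuous z}.
Proof. by move=> dz; apply/differentiable_continuous/derivable1_diffP. Qed.

Lemma is_derive1 (V : normedModType R) (z : R -> V) (t : R) :
  derivable z t 1 -> is_derive t 1 z (derive1 z t).
Proof. by move=> dz; rewrite derive1E; exact: derivableP. Qed.

Lemma solves_christoffel1 z t w : solves a z t ->
  gram a (z t) (derive1 (derive1 z) t) w = - christoffel1 a (z t) (derive1 z t) (derive1 z t) w.
Proof.
move=> [Oz _ _ /eqP]; rewrite addr_eq0 => /eqP ->.
by rewrite (innerNl (gram_inner Oz)) gram_christoffel.
Qed.

Let S1 := nbhs_singleton s1.
Let S2 := nbhs_singleton s2.

Let dom_e_dlt : dominated t0 e (fun t => `|dlt t|).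
Proof.
exists 1; apply: (@nearW _ (nbhs t0)) => t.
by rewrite normr_id mul1r /e lerDl.
Qed.

Let dom_C1 (c : E -> R) : Ck 1 O c -> dominated t0 e (fun t => c (z1 t) - c (z2 t)).
Proof.
move=> cO; have [Oz1 d1 _ _] := S1; have [_ d2 _ _] := S2.
have [C [r [r0 H]]] := C1_lipschitz (ccod_open (chart_of a)) cO Oz1.
have b1 : \forall t \near t0, ball (z1 t0) r (z1 t).
  by apply: (derivable_cont d1); exact: nbhsx_ballx.
have b2 : \forall t \near t0, ball (z1 t0) r (z2 t).
  by rewrite zE; apply: (derivable_cont d2); exact: nbhsx_ballx.
have [D HD] := dom_e_dlt.
exists (`|C| * D); apply: filterS3 b1 b2 HD => t h1 h2 h3.
rewrite (le_trans (H _ _ h1 h2)) // -mulrA.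
apply: (@le_trans _ _ (`|C| * `|dlt t|)); first by rewrite ler_wpM2r // ler_norm.
by rewrite ler_wpM2l // -[leLHS]normr_id.
Qed.

Let dom_vel K : dominated t0 e (fun t => entry (derive1 z1 t) K - entry (derive1 z2 t) K).
Proof.
exists 1; apply: (@nearW _ (nbhs t0)) => t; rewrite mul1r.
have -> : entry (derive1 z1 t) K - entry (derive1 z2 t) K = entry (ddlt t) K by rewrite /entry !mxE.
by rewrite (le_trans (entry_le _ _)) // /e lerDr.
Qed.

Let bdd_vel (z : R -> E) K : derivable (derive1 z) t0 1 -> dominated t0 (fun=> 1) (fun t => entry (derive1 z t) K).
Proof.
move=> dz; apply: dominated_cont.
apply: (continuous_comp (f := derive1 z) (g := fun u : E => entry u K)); first exact: derivable_cont.
exact: entry_continuous.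
Qed.

Let bdd_comp (z : R -> E) (c : E -> R) : derivable z t0 1 -> {for z t0, continuous c} ->
  dominated t0 (fun=> 1) (fun t => c (z t)).
Proof.
move=> dz cc; apply: dominated_cont.
by apply: (continuous_comp (f := z) (g := c)) => //; exact: derivable_cont.
Qed.

Let quad (z : R -> E) w t := christoffel1 a (z t) (derive1 z t) (derive1 z t) w.
Let coef (w : E) K J (y : E) := 'D_(elem K) (fun z => gram a z (elem J) w) y
      - 2^-1 * 'D_w (fun z => gram a z (elem K) (elem J)) y.

Let quadE (z : R -> E) w : (\forall t \near t0, solves a z t) ->
  \forall t \near t0, quad z w t =
    \sum_K \sum_J entry (derive1 z t) K * (entry (derive1 z t) J * coef w K J (z t)).
Proof. by apply: filterS => t [Oz _ _ _]; rewrite /quad christoffel1_quad. Qed.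

Let bdd_coef (z : R -> E) w K J : solves a z t0 -> dominated t0 (fun=> 1) (fun t => coef w K J (z t)).
Proof.
move=> [Oz dz _ _]; apply: (bdd_comp (c := coef w K J)) => //.
apply: continuousB; first by apply: (gram_smooth a (elem J) w 1).2.
by apply: continuousM; [exact: cst_continuous|apply: (gram_smooth a (elem K) (elem J) 1).2].
Qed.

Let dom_coef w K J : dominated t0 e (fun t => coef w K J (z1 t) - coef w K J (z2 t)).
Proof.
have H1 := dom_C1 ((gram_smooth a (elem J) w 2).2 (elem K)).
have H2 := dom_C1 ((gram_smooth a (elem K) (elem J) 2).2 w).
have b2 : dominated t0 (fun=> 1) (fun=> - 2^-1) by apply: dominated_cont; exact: cst_continuous.
apply: (dominated_ext (dominatedD H1 (dominatedM H2 b2))); apply: (@nearW _ (nbhs t0)) => t.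
rewrite /coef; ring.
Qed.

Let dom_quad w : dominated t0 e (fun t => quad z1 w t - quad z2 w t).
Proof.
have [_ _ dd1 _] := S1; have [_ _ dd2 _] := S2.
have H : dominated t0 e (fun t => \sum_K \sum_J
  (entry (derive1 z1 t) K * (entry (derive1 z1 t) J * coef w K J (z1 t))
   - entry (derive1 z2 t) K * (entry (derive1 z2 t) J * coef w K J (z2 t)))).
  apply: dominated_sum => K; apply: dominated_sum => J.
  apply: dominated_diffM => //; last exact: bdd_vel.
    by apply: dominated_diffM => //; [exact: bdd_coef|exact: bdd_vel].
  by apply: dominatedM; [exact: bdd_vel|exact: bdd_coef].
apply: (dominated_ext H); apply: filterS2 (quadE w s1) (quadE w s2) => t -> ->.
by rewrite -sumrB; apply: eq_bigr => K _; rewrite -sumrB.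
Qed.

Let bdd_quad w : dominated t0 (fun=> 1) (quad z2 w).
Proof.
have [_ _ dd2 _] := S2.
have H : dominated t0 (fun=> 1) (fun t => \sum_K \sum_J
   entry (derive1 z2 t) K * (entry (derive1 z2 t) J * coef w K J (z2 t))).
  apply: dominated_sum => K; apply: dominated_sum => J.
  by apply: dominatedM; [exact: bdd_vel|apply: dominatedM; [exact: bdd_vel|exact: bdd_coef]].
exact: (dominated_ext H (quadE w s2)).
Qed.

Let coercive (z : R -> E) : solves a z t0 -> exists C : R, 0 <= C /\ \forall t \near t0,
  forall u, `|u| <= C * \sum_J `|gram a (z t) u (elem J)|.
Proof.
move=> [Oz dz _ _]; have [C [C0 H]] := gram_coercive Oz.
exists C; split=> //.
by have := derivable_cont dz H.
Qed.

Let dom_norm f X : dominated t0 f X -> dominated t0 f (fun t => `|X t|).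
Proof. by move=> [C HC]; exists C; apply: filterS HC => t; rewrite normr_id. Qed.

Let bdd_acc K : dominated t0 (fun=> 1) (fun t => entry (derive1 (derive1 z2) t) K).
Proof.
have [C [C0 HC]] := coercive S2.
have H : dominated t0 (fun=> 1) (fun t => (\sum_J `| quad z2 (elem J) t|) * C).
  apply: dominatedM; last by apply: dominated_cont; exact: cst_continuous.
  by apply: dominated_sum => J; apply: dom_norm; exact: bdd_quad.
apply: (dominated_bound H); apply: filterS2 HC s2 => t h1 h2.
rewrite (le_trans (entry_le _ _)) // (le_trans (h1 _)) // mulrC.
by under eq_bigr do rewrite (solves_christoffel1 _ h2) normrN.
Qed.

Let dom_acc : dominated t0 e (fun t => `|derive1 (derive1 z1) t - derive1 (derive1 z2) t|).
Proof.
have [C [C0 HC]] := coercive S1.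
pose G J t := gram a (z1 t) (derive1 (derive1 z2) t) (elem J)
   - gram a (z2 t) (derive1 (derive1 z2) t) (elem J).
have dG J : dominated t0 e (G J).
  have H : dominated t0 e (fun t => \sum_K (gram a (z1 t) (elem K) (elem J)
     - gram a (z2 t) (elem K) (elem J)) * entry (derive1 (derive1 z2) t) K).
    apply: dominated_sum => K; apply: dominatedM; last exact: bdd_acc.
    exact: (dom_C1 (gram_smooth a (elem K) (elem J) 1)).
  apply: (dominated_ext H); apply: filterS2 s1 s2 => t [Oz1 _ _ _] [Oz2 _ _ _].
  rewrite /G (inner_entryl (gram_inner Oz1)) (inner_entryl (gram_inner Oz2)) -sumrB.
  by apply: eq_bigr => K _; rewrite -mulrBr mulrC.
have H : dominated t0 e (fun t => (\sum_J `|(quad z1 (elem J) t - quad z2 (elem J) t) + G J t|) * C).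
  apply: dominatedM; last by apply: dominated_cont; exact: cst_continuous.
  by apply: dominated_sum => J; apply: dom_norm; apply: dominatedD => //; exact: dom_quad.
apply: (dominated_bound H); apply: filterS3 HC s1 s2 => t h1 h2 h3.
rewrite normr_id (le_trans (h1 _)) // mulrC ler_wpM2r // ler_sum // => J _.
have [Oz1 _ _ _] := h2; have innerBl := innerBl (gram_inner Oz1).
have E1 : gram a (z1 t) (derive1 (derive1 z1) t - derive1 (derive1 z2) t) (elem J) =
    - quad z1 (elem J) t - gram a (z1 t) (derive1 (derive1 z2) t) (elem J).
  by rewrite -(solves_christoffel1 (elem J) h2) innerBl.
have E2 : gram a (z2 t) (derive1 (derive1 z2) t) (elem J) = - quad z2 (elem J) t.
  exact: solves_christoffel1.
have alg (p q r : R) : - (- p - r) = p - q + (r - - q) by ring.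
have E3 : - (- quad z1 (elem J) t - gram a (z1 t) (derive1 (derive1 z2) t) (elem J)) =
    quad z1 (elem J) t - quad z2 (elem J) t + G J t by rewrite /G E2; exact: alg.
by rewrite E1 -normrN E3.
Qed.

(** The difference of the two solutions satisfies a linear second-order
    inequality: the coefficients of the equation are Lipschitz, and gram_coercive
    inverts the metric with a uniform bound. *)
Lemma solves_unique : \forall t \near t0, z1 t = z2 t.
Proof.
have [C HC] := dom_acc.
have H : \forall t \near t0, dlt t = 0.
  apply: (@second_order_zero _ _ _ dlt ddlt (fun t => derive1 (derive1 z1) t - derive1 (derive1 z2) t) t0 C).
  - by rewrite /dlt zE subrr.
  - by rewrite /ddlt dzE subrr.
  apply: filterS3 s1 s2 HC => t [_ d1 dd1 _] [_ d2 dd2 _].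
  rewrite normr_id => h; split; last exact: h.
    exact: (is_deriveB (is_derive1 d1) (is_derive1 d2)).
  exact: (is_deriveB (is_derive1 dd1) (is_derive1 dd2)).
by apply: filterS H => t /eqP; rewrite subr_eq0 => /eqP.
Qed.

End local.

End geodesic_uniqueness.

(** * Global uniqueness of geodesics; exponential map *)

Section one_sided.
Context {R : realType}.

Lemma closure_eq (T : topologicalType) (f g : R -> T) (C : set R) (t : R) :
  hausdorff_space T -> {for t, continuous f} -> {for t, continuous g} ->
  closure C t -> (forall s, C s -> f s = g s) -> f t = g t.
Proof.
move=> hT cf cg Ct fg; apply: hT => A B nA nB.
have nf : nbhs t (f @^-1` A) by exact: cf.
have ng : nbhs t (g @^-1` B) by exact: cg.
have [s [Cs [As Bs]]] := Ct _ (filterI nf ng).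
by exists (f s); split=> //; rewrite fg.
Qed.

Lemma derive1_eq_right (V : normedModType R) (f g : R -> V) (t e : R) : 0 < e ->
  derivable f t 1 -> derivable g t 1 ->
  (forall s, t <= s < t + e -> f s = g s) -> derive1 f t = derive1 g t.
Proof.
move=> e0 df dg fg; rewrite !derive1E /derive.
rewrite (cvg_at_rightE _ 0 df) (cvg_at_rightE _ 0 dg); congr (lim _).
have H : \forall h \near 0^'+, h^-1 *: ((f \o shift t) (h *: 1) - f t) =
    h^-1 *: ((g \o shift t) (h *: 1) - g t).
  near=> h; have h0 : 0 < h by [].
  have he : h < e by near: h; exact: nbhs_right_lt.
  rewrite /= /GRing.scale /= mulr1 !fg //; first by rewrite lexx ltrDl.
  by rewrite lerDr ltW //= addrC ltrD2l.
by apply/seteqP; split; apply: near_eq_cvg => //; apply: filterS H => h ->.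
Unshelve. all: by end_near. Qed.

Lemma derive1_eq_left (V : normedModType R) (f g : R -> V) (t e : R) : 0 < e ->
  derivable f t 1 -> derivable g t 1 ->
  (forall s, t - e < s <= t -> f s = g s) -> derive1 f t = derive1 g t.
Proof.
move=> e0 df dg fg; rewrite !derive1E /derive.
rewrite (cvg_at_leftE _ 0 df) (cvg_at_leftE _ 0 dg); congr (lim _).
have H : \forall h \near 0^'-, h^-1 *: ((f \o shift t) (h *: 1) - f t) =
    h^-1 *: ((g \o shift t) (h *: 1) - g t).
  near=> h; have h0 : h < 0 by [].
  have he : - e < h by near: h; apply: nbhs_left_gt; rewrite oppr_lt0.
  rewrite /= /GRing.scale /= mulr1 !fg //; first by rewrite lexx ltrBlDr ltrDl e0.
  by rewrite gerDr ltW // andbT addrC ltrD2r.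
by apply/seteqP; split; apply: near_eq_cvg => //; apply: filterS H => h ->.
Unshelve. all: by end_near. Qed.

End one_sided.

Section geodesics.
Context {R : realType} {m d : nat} {N : riemannian 'M[R]_(m, d)}.
Notation E := 'M[R]_(m, d).
Implicit Types (c : R -> N) (a : atlas N).

Lemma near_cdom a c (t : R) : {for t, continuous c} -> cdom (chart_of a) (c t) ->
  \forall s \near t, cdom (chart_of a) (c s).
Proof. by move=> cc ct; apply: cc; apply: open_nbhs_nbhs; split=> //; exact: cdom_open. Qed.

Lemma geodesic_solves (I : set R) c (t : R) a : open I -> geodesic_on I c -> I t ->
  cdom (chart_of a) (c t) -> \forall s \near t, solves a (cmap (chart_of a) \o c) s.
Proof.
move=> oI gc It ct; have [cc _] := gc t It.
have nI : \forall s \near t, I s by exact: open_nbhs_nbhs.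
apply: filterS2 nI (near_cdom cc ct) => s Is cs.
have [_ /(_ a cs) [d1 d2 d3]] := gc s Is.
by split; [exact: cmap_cod|exact: d1|exact: d2|exact: d3].
Qed.

Lemma geodesic_agree_near (I : set R) c1 c2 (t : R) a : open I ->
  geodesic_on I c1 -> geodesic_on I c2 -> I t -> cdom (chart_of a) (c1 t) ->
  c1 t = c2 t ->
  derive1 (cmap (chart_of a) \o c1) t = derive1 (cmap (chart_of a) \o c2) t ->
  \forall s \near t, c1 s = c2 s.
Proof.
move=> oI g1 g2 It c1t c12 dc12.
have c2t : cdom (chart_of a) (c2 t) by rewrite -c12.
have := solves_unique (geodesic_solves oI g1 It c1t) (geodesic_solves oI g2 It c2t).
rewrite /= c12 => /(_ erefl dc12) H.
have n1 := near_cdom (g1 t It).1 c1t; have n2 := near_cdom (g2 t It).1 c2t.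
apply: filterS3 n1 n2 H => s h1 h2 h.
by rewrite -(cmapK h1) h cmapK.
Qed.

(** The times near which the two geodesics agree form an open set. It is also
    closed: at a limit time the positions agree because the manifold is
    Hausdorff, the velocities agree by continuity, and local uniqueness applies.
    Hence it is all of [0, 1]. *)
Lemma geodesic_on_unique (I : set R) c1 c2 : open I -> `[0, 1]%classic `<=` I ->
  geodesic_on I c1 -> geodesic_on I c2 -> c1 0 = c2 0 ->
  velocity c1 0 = velocity c2 0 :> E -> forall t, 0 <= t <= 1 -> c1 t = c2 t.
Proof.
move=> oI sI g1 g2 c12 v12.
pose C : set R := [set t | \forall s \near t, c1 s = c2 s].
have CE t : C t -> c1 t = c2 t by move=> /nbhs_singleton.
have clC t : I t -> closure C t -> C t.
  move=> It Ct; have E12 : c1 t = c2 t.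
    exact: (closure_eq (@manifold_hausdorff _ _ N) (g1 t It).1 (g2 t It).1 Ct CE).
  pose a := chart_at (c1 t).
  have d1 : cdom (chart_of a) (c1 t) by exact: chart_atP.
  have d2 : cdom (chart_of a) (c2 t) by rewrite -E12.
  apply: (geodesic_agree_near oI g1 g2 It d1 E12).
  have [_ /(_ a d1) /= [_ dd1 _]] := g1 t It.
  have [_ /(_ a d2) /= [_ dd2 _]] := g2 t It.
  apply: (closure_eq (@norm_hausdorff _ E) (derivable_cont dd1) (derivable_cont dd2) Ct).
  move=> s Cs; rewrite !derive1E; apply: near_eq_derive.
  by apply: filterS Cs => r /= ->.
have H : [set t | `[0, 1]%classic t /\ C t] = `[0, 1]%classic.
  apply: (@segment_connected R 0 1).
  - exists 0; split; first by rewrite /= in_itv /= lexx ler01.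
    have I0 : I 0 by apply: sI; rewrite /= in_itv /= lexx ler01.
    apply: (geodesic_agree_near oI g1 g2 I0 (chart_atP (c1 0)) c12).
    by move: v12; rewrite /velocity /coord -c12.
  - exists C => //; rewrite openE => t Ct; exact: nbhs_interior.
  - exists (closure C); first exact: closed_closure.
    apply/seteqP; split=> t [It Ct]; split=> //; first exact: subset_closure.
    by apply: clC => //; exact: sI.
move=> t t01; apply: CE.
have : `[0, 1]%classic t by rewrite /= in_itv.
by rewrite -H => -[].
Qed.

Lemma near01_common (P : set R -> (R -> N) -> Prop) c :
  (forall I J c, I `<=` J -> P J c -> P I c) -> near01 P c ->
  forall c', near01 P c' -> exists I : set R, [/\ open I, `[0, 1]%classic `<=` I, P I c & P I c'].
Proof.
move=> Pm [e e0 Pe] c' [e' e'0 Pe'].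
pose r := Num.min e e'.
have r0 : 0 < r by rewrite lt_min e0.
have re : r <= e by rewrite ge_min lexx.
have re' : r <= e' by rewrite ge_min lexx orbT.
exists `](- r), (1 + r)[%classic; split.
- exact: interval_open.
- by move=> t; rewrite /= !in_itv /= => /andP[? ?]; apply/andP; split; lra.
- apply: Pm Pe => t; rewrite /= !in_itv /= => /andP[? ?]; apply/andP; split; lra.
- apply: Pm Pe' => t; rewrite /= !in_itv /= => /andP[? ?]; apply/andP; split; lra.
Qed.

Lemma geodesic_on_sub (I J : set R) c : I `<=` J -> geodesic_on J c -> geodesic_on I c.
Proof. by move=> IJ g t /IJ; exact: g. Qed.

Lemma geodesic_unique c1 c2 : geodesic c1 -> geodesic c2 -> c1 0 = c2 0 ->
  velocity c1 0 = velocity c2 0 :> E -> forall t, 0 <= t <= 1 -> c1 t = c2 t.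
Proof.
move=> g1 g2; have [I [oI sI h1 h2]] := near01_common (@geodesic_on_sub) g1 g2.
exact: (geodesic_on_unique oI sI h1 h2).
Qed.

Lemma affine_cont (al be t : R) : {for t, continuous (fun s : R => al * s + be)}.
Proof.
apply: continuousD; last exact: cst_continuous.
by apply: continuousM; [exact: cst_continuous|].
Qed.

Lemma near_affine (al be t : R) (P : R -> Prop) :
  (\forall u \near (al * t + be), P u) -> \forall s \near t, P (al * s + be).
Proof. by move=> H; have := @affine_cont al be t P H. Qed.

Lemma is_derive_affine (z : R -> E) (al be t : R) : derivable z (al * t + be) 1 ->
  is_derive t 1 (fun s => z (al * s + be)) (al *: derive1 z (al * t + be)).
Proof.
move=> dz.
have da : is_derive t 1 (fun s : R => al * s + be) al.
  have -> : (fun s : R => al * s + be) = fun s => be + s *: al.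
    by apply/funext => s; rewrite addrC mulrC.
  exact: is_derive_line.
have dz' : differentiable z (al * t + be) by apply/derivable1_diffP.
have -> : al *: derive1 z (al * t + be) = 'D_al z (al * t + be).
  by rewrite derive1E !deriveE // -linearZ /= [al *: _]mulr1.
exact: is_derive_comp da dz'.
Qed.

(** The reparametrization multiplies both the acceleration and the Christoffel
    term, which is quadratic in the velocity, by al ^+ 2. *)
Lemma geodesic_on_affine (I J : set R) c (al be : R) : open I ->
  geodesic_on I c -> (forall t, J t -> I (al * t + be)) ->
  geodesic_on J (fun t => c (al * t + be)).
Proof.
move=> oI gc JI t Jt; have It := JI t Jt; have [cc H] := gc _ It.
split; first by apply: (continuous_comp (f := fun s => al * s + be)) => //; exact: affine_cont.
move=> a ct /=; pose z := cmap (chart_of a) \o c.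
have [dz ddz ode] := H a ct.
have nz : \forall s \near t, solves a z (al * s + be).
  exact (near_affine (geodesic_solves oI gc It ct)).
have D1 := is_derive_affine dz.
have D2 := is_derive_affine ddz.
have E1 : \forall s \near t, al *: derive1 z (al * s + be) =
    derive1 (cmap (chart_of a) \o (fun t => c (al * t + be))) s.
  apply: filterS nz => s [_ ds _ _]; symmetry; rewrite derive1E.
  by case: (is_derive_affine ds).
have D2' := near_eq_is_derive E1 (is_deriveZ al D2).
have E2 := nbhs_singleton E1.
split.
- by case: D1.
- by case: D2'.
rewrite -E2 derive1E; case: D2' => _ ->.
rewrite christoffel_scale; last exact: cmap_cod.
by rewrite scalerA -expr2 -scalerDr ode scaler0.
Qed.

Lemma velocity_affine (I : set R) c (al be t : R) : geodesic_on I c -> I (al * t + be) ->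
  velocity (fun t => c (al * t + be)) t = al *: velocity c (al * t + be) :> E.
Proof.
move=> gc It; have [_ /(_ _ (chart_atP _)) /= [dz _ _]] := gc _ It.
have D := is_derive_affine dz.
by rewrite /velocity derive1E; case: D.
Qed.

(** Exp picks an endpoint among those of the geodesics with the given initial
    velocity; by uniqueness of geodesics there is only one. *)
Lemma Exp_eq p (v : tangent p) c : geodesic c -> c 0 = p -> velocity c 0 = v :> E ->
  Exp v = c 1.
Proof.
move=> gc c0 vc; rewrite /Exp; case: xgetP => [q _ [c' [gc' c'0 vc' <-]]|/(_ (c 1))].
  by apply: geodesic_unique; rewrite ?c0 ?c'0 ?vc ?vc' // lexx ler01.
by case; exists c.
Qed.

Lemma geodesic_scale c (t : R) : geodesic c -> 0 <= t <= 1 ->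
  geodesic (fun s => c (t * s + 0)) /\ velocity (fun s => c (t * s + 0)) 0 = t *: velocity c 0 :> E.
Proof.
move=> [e e0 gc] /andP[t0 t1]; split.
  exists e => //; apply: (geodesic_on_affine _ gc); first exact: interval_open.
  move=> s; rewrite /= !in_itv /= addr0 => /andP[s1 s2].
  have [->|tn0] := eqVneq t 0; first by rewrite mul0r; apply/andP; split; lra.
  have tp : 0 < t by rewrite lt_neqAle eq_sym tn0.
  have a1 : 0 < t * (s + e) by apply: mulr_gt0 => //; lra.
  have a2 : 0 <= (1 - t) * e by apply: mulr_ge0; lra.
  have a3 : 0 < t * (1 + e - s) by apply: mulr_gt0 => //; lra.
  have a4 : 0 <= (1 - t) * (1 + e) by apply: mulr_ge0; lra.
  by apply/andP; split; lra.
rewrite (velocity_affine gc) ?mulr0 ?addr0 //.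
by rewrite /= in_itv /=; apply/andP; split; lra.
Qed.

Lemma Exp_ray p (v : tangent p) c (t : R) : geodesic c -> c 0 = p -> velocity c 0 = v :> E ->
  0 <= t <= 1 -> Exp (t *: v : tangent p) = c t.
Proof.
move=> gc c0 vc t01; have [g' v'] := geodesic_scale gc t01.
have c'0 : c (t * 0 + 0) = p by rewrite mulr0 addr0.
have := @Exp_eq p (t *: v : tangent p) (fun s => c (t * s + 0)) g' c'0.
by rewrite v' vc mulr1 addr0; apply.
Qed.

Lemma geodesic_reverse c : geodesic c ->
  geodesic (fun s => c (-1 * s + 1)) /\ velocity (fun s => c (-1 * s + 1)) 0 = - velocity c 1 :> E.
Proof.
move=> [e e0 gc]; split.
  exists e => //; apply: (geodesic_on_affine _ gc); first exact: interval_open.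
  move=> s; rewrite /= !in_itv /= => /andP[s1 s2]; apply/andP; split; lra.
rewrite (velocity_affine gc) ?mulr0 ?add0r ?scaleN1r //.
by rewrite /= in_itv /=; apply/andP; split; lra.
Qed.

End geodesics.

(** * Derivatives of real and matrix-valued maps *)

Section real_lemmas.
Context {R : realType}.

Lemma increment_constant_derivative (f : R -> R) (k a b : R) : a <= b ->
  (forall x : R, a <= x <= b -> derivable f x 1) ->
  (forall x : R, a < x < b -> is_derive x 1 f k) -> f b - f a = k * (b - a).
Proof.
move=> ab df dk.
have cf : {within `[a, b], continuous f}.
  by apply: derivable_within_continuous => x; rewrite in_itv /= => ?; exact: df.
have dk' (x : R) : x \in `]a, b[ -> is_derive x 1 f k by rewrite in_itv; exact: dk.
have [c _ E] := @MVT_segment _ f (fun=> k) a b ab dk' cf.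
exact: E.
Qed.

Lemma is_derive_quadratic (g0 g1 g2 : R -> R) (d0 : R) :
  is_derive (0 : R) 1 g0 d0 -> derivable g1 0 1 -> derivable g2 0 1 ->
  is_derive (0 : R) 1 (fun s => g0 s + 2 * (s * g1 s) + s * (s * g2 s)) (d0 + 2 * g1 0).
Proof.
have M (g : R -> R) : derivable g 0 1 -> is_derive (0 : R) 1 (fun s => s * g s) (g 0).
  move=> /derivableP dg; have := is_deriveM (is_derive_id (0 : R) 1) dg.
  by rewrite /GRing.scale /= mul0r add0r mulr1.
move=> d0' d1 d2; have [d3 _] := M _ d2; have M3 := M _ d3; rewrite mul0r in M3.
have := is_deriveD (is_deriveD d0' (is_deriveZ 2 (M _ d1))) M3.
by rewrite addr0.
Qed.

End real_lemmas.

Section Ck_coordinates.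
Context {R : realType} {m d : nat}.
Notation E := 'M[R]_(m, d).

Lemma derive_entry_comp (V : normedModType R) (f : V -> E) x v K : differentiable f x ->
  'D_v (fun y => entry (f y) K) x = entry ('D_v f x) K.
Proof.
by move=> df; case: (is_derive_entry K (derivableP (@diff_derivable _ _ _ _ _ v df))).
Qed.

Lemma Ck_entry (V : normedModType R) k (O : set V) (f : V -> E) K : open O ->
  Ck k O f -> Ck k O (fun y => entry (f y) K).
Proof.
move=> oO; elim: k f => [|k IH] f /=.
  move=> cf x Ox; apply: (continuous_comp (f := f) (g := fun u : E => entry u K)).
    exact: cf.
  exact: entry_continuous.
case=> df Cf; split=> [x Ox|v].
  apply: (differentiable_comp (f := f) (g := fun u : E => entry u K)).
    exact: df.
  exact: differentiable_entry.
apply: (Ck_ext oO _ (IH _ (Cf v))) => x Ox.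
by rewrite derive_entry_comp //; exact: df.
Qed.

Lemma schwarz_mx (V : normedModType R) (O : set V) (f : V -> E) x u v :
  open O -> Ck 2 O f -> O x ->
  'D_u (fun y => 'D_v f y) x = 'D_v (fun y => 'D_u f y) x.
Proof.
move=> oO C2 Ox.
have nO : nbhs x O by exact: open_nbhs_nbhs.
have E1 a b K : 'D_a (fun y => 'D_b (fun y => entry (f y) K) y) x =
    entry ('D_a (fun y => 'D_b f y) x) K.
  have N1 : \forall y \near x, 'D_b (fun y => entry (f y) K) y = entry ('D_b f y) K.
    by apply: filterS nO => y Oy; apply: derive_entry_comp; exact: C2.1.
  rewrite (near_eq_derive a N1); apply: derive_entry_comp.
  exact: (C2.2 b).1.
apply/matrixP => i j.
have := schwarz u v oO (Ck_entry (i, j) oO C2) Ox.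
by rewrite !E1.
Qed.

End Ck_coordinates.

(** * The logarithm on a normal neighborhood *)

Section logarithm.
Context {R : realType} {m d : nat} {N : riemannian 'M[R]_(m, d)}.
Notation E := 'M[R]_(m, d).

Definition unique_joins (U : set N) : Prop := forall p q c c',
  geodesic c -> joins U p q c -> geodesic c' -> joins U p q c' ->
  forall t : R, 0 <= t <= 1 -> c' t = c t.

Lemma geodesic_derivable (c : R -> N) a (t : R) : geodesic c -> 0 <= t <= 1 ->
  cdom (chart_of a) (c t) -> derivable (cmap (chart_of a) \o c) t 1.
Proof.
move=> [e e0 gc] /andP[t0 t1] ct.
have It : `](- e), (1 + e)[%classic t.
  by rewrite /= in_itv /=; apply/andP; split; lra.
by have [_ /(_ a ct) []] := gc t It.
Qed.

Lemma velocity_eq_right (c c' : R -> N) : geodesic c -> geodesic c' ->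
  (forall t : R, 0 <= t <= 1 -> c' t = c t) -> velocity c' 0 = velocity c 0 :> E.
Proof.
move=> gc gc' cc'; have I0 : 0 <= (0 : R) <= 1 by rewrite lexx ler01.
rewrite /velocity (cc' 0 I0) /coord.
have dc := geodesic_derivable gc I0 (chart_atP (c 0)).
have dc' : derivable (cmap (chart_of (chart_at (c 0))) \o c') 0 1.
  by apply: (geodesic_derivable gc' I0); rewrite (cc' 0 I0); exact: chart_atP.
apply: (derive1_eq_right ltr01 dc' dc) => s /andP[s0 s1].
by rewrite /= cc' // s0 ltW // -[1]add0r.
Qed.

(** Log picks the initial velocity of some geodesic of U joining p to q,
    and all of them have the same values on [0, 1]. *)
Lemma Log_eq (U : set N) p q c : unique_joins U -> geodesic c -> joins U p q c ->
  Log U p q = velocity c 0 :> E.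
Proof.
move=> uU gc jc; rewrite /Log; case: xgetP => [v _ [c' [gc' jc' <-]]|H].
  apply: velocity_eq_right => // t t01; exact: (uU _ _ _ _ gc jc gc' jc').
by case: (H (velocity c 0)); exists c.
Qed.

Context (U : set N) (p : N) (V : set (tangent p)) (L : N -> tangent p).
Context (uU : unique_joins U).
Context (oV : open V).
Context (V0 : V 0).
Context (starV : forall v (t : R), V v -> 0 <= t <= 1 -> V (t *: v)).
Context (VExp : V `<=` @Exp_dom R E N p).
Context (ExpU : forall v, V v -> U (Exp v)).
Context (LU : forall q, U q -> V (L q) /\ Exp (L q) = q).

Lemma ray v : V v -> exists c, [/\ geodesic c, c 0 = p, velocity c 0 = v :> E &
  forall t : R, 0 <= t <= 1 -> c t = Exp (t *: v : tangent p)].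
Proof.
move=> Vv; have [q [c [gc c0 vc _]]] := VExp Vv.
by exists c; split=> // t t01; rewrite (Exp_ray gc c0 vc t01).
Qed.

Lemma ray_joins v c : V v -> geodesic c -> c 0 = p -> velocity c 0 = v :> E ->
  joins U p (Exp v) c.
Proof.
move=> Vv gc c0 vc; split=> //.
  by rewrite -(Exp_ray gc c0 vc) ?scale1r // lexx ler01.
by move=> t t01; rewrite -(Exp_ray gc c0 vc t01); apply: ExpU; exact: starV.
Qed.

(** The ray of v stays in U since V is star-shaped, so it is the geodesic of U
    joining p to Exp v. *)
Lemma Log_Exp v : V v -> Log U p (Exp v) = v.
Proof.
move=> Vv; have [c [gc c0 vc _]] := ray Vv.
by rewrite (Log_eq uU gc (ray_joins Vv gc c0 vc)).
Qed.

Lemma LogE q : U q -> Log U p q = L q.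
Proof. by move=> Uq; have [VL EL] := LU Uq; rewrite -{1}EL Log_Exp. Qed.

(** The geodesic of U from Exp v back to p is the reversed ray. *)
Lemma Log_back v c : V v -> geodesic c -> c 0 = p -> velocity c 0 = v :> E ->
  Log U (Exp v) p = - velocity c 1 :> E.
Proof.
move=> Vv gc c0 vc; have [c0' c1 cU] := ray_joins Vv gc c0 vc.
have [gr vr] := geodesic_reverse gc.
rewrite -vr; apply: (Log_eq uU gr); split.
- by rewrite mulr0 add0r.
- by rewrite mulN1r addNr.
- by move=> t /andP[t0 t1]; apply: cU; rewrite mulN1r; apply/andP; split; lra.
Qed.

(** * The Gauss lemma *)

Context (smoothExp : smooth_into V (@Exp R E N p)).
Notation F := (@Exp R E N p).
Let H a : E -> E := cmap (chart_of a) \o F.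
Let D a : set E := V `&` F @^-1` cdom (chart_of a).

Lemma open_Exp_chart a : open (D a).
Proof.
rewrite openE => v [Vv av].
have nV : nbhs v V by exact: open_nbhs_nbhs.
have nF : nbhs (F v) (cdom (chart_of a)).
  by apply: open_nbhs_nbhs; split=> //; exact: cdom_open.
exact: (filterI nV (smoothExp.1 v Vv _ nF)).
Qed.

Lemma near_Exp_chart a v : D a v -> nbhs v (D a).
Proof. by move=> Dv; apply: open_nbhs_nbhs; split=> //; exact: open_Exp_chart. Qed.

Lemma CkH k a : Ck k (D a) (H a).
Proof. exact: smoothExp.2. Qed.

Lemma diffH a v : D a v -> differentiable (H a) v.
Proof. exact: (CkH 1 a).1. Qed.

Lemma diffDH a u v : D a v -> differentiable (fun y => 'D_u (H a) y) v.
Proof. exact: ((CkH 2 a).2 u).1. Qed.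

Lemma ccodH a v : D a v -> ccod (chart_of a) (H a v).
Proof. by case=> _ av; exact: cmap_cod. Qed.

(** The metric pulled back to the tangent space by the exponential map, computed
    in the chart a. *)
Definition pull a (xi u w : E) : R :=
  gram a (H a xi) ('D_u (H a) xi) ('D_w (H a) xi).

Lemma pull_chart a b xi u w : D a xi -> D b xi -> pull a xi u w = pull b xi u w.
Proof.
move=> Da Db; case: (Da) => Vxi ax; case: (Db) => _ bx.
rewrite /pull (gram_compat ax bx).
pose T := cmap (chart_of b) \o cinv (chart_of a).
have dT : differentiable T (H a xi).
  by apply: (transition_smooth a b 1).1; exists (F xi).
have E1 v : 'd T (H a xi) ('D_v (H a) xi) = 'D_v (H b) xi.
  rewrite -(deriveE _ dT) -(derive_comp v (diffH Da) dT).
  apply: near_eq_derive; apply: filterS (near_Exp_chart Da) => y [_ ay].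
  by rewrite /T /H /= cmapK.
by rewrite -!E1.
Qed.

Lemma pull_inner a xi : D a xi ->
  [/\ forall u w, pull a xi u w = pull a xi w u,
      forall k u v w, pull a xi (k *: u + v) w = k * pull a xi u w + pull a xi v w &
      forall k u v w, pull a xi w (k *: u + v) = k * pull a xi w u + pull a xi w v].
Proof.
move=> Da; have iG := gram_inner (ccodH Da); have dH := diffH Da.
have S u w : pull a xi u w = pull a xi w u by exact (innerC iG _ _).
have Lr k u v w : pull a xi w (k *: u + v) = k * pull a xi w u + pull a xi w v.
  by rewrite /pull (deriveD_dir _ _ _ dH) (innerDr iG) (innerZr iG).
by split; [exact: S|move=> k u v w; rewrite S Lr !(S w)|exact: Lr].
Qed.

(** The derivative of xi |-> pull a xi u w in the direction n. *)
Definition dpull a (xi n u w : E) : R :=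
  'D_('D_n (H a) xi) (fun y => gram a y ('D_u (H a) xi) ('D_w (H a) xi)) (H a xi)
  + gram a (H a xi) ('D_n (fun y => 'D_u (H a) y) xi) ('D_w (H a) xi)
  + gram a (H a xi) ('D_u (H a) xi) ('D_n (fun y => 'D_w (H a) y) xi).

Lemma is_derive_pull a (xi : R -> E) (t : R) n u w : D a (xi t) -> is_derive t 1 xi n ->
  is_derive t 1 (fun s => pull a (xi s) u w) (dpull a (xi t) n u w).
Proof.
move=> Da dxi; apply: is_derive_gram.
- exact: ccodH.
- exact: (is_derive_comp dxi (diffH Da)).
- exact: (is_derive_comp dxi (diffDH u Da)).
- exact: (is_derive_comp dxi (diffDH w Da)).
Qed.

Lemma dpull_linear a xi k n u w : D a xi -> dpull a xi (k *: n) u w = k * dpull a xi n u w.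
Proof.
move=> Da; have iG := gram_inner (ccodH Da).
have dZ (W : normedModType R) (f : E -> W) y x : differentiable f y -> 'D_(k *: x) f y = k *: 'D_x f y.
  by move=> df; rewrite !deriveE // linearZ.
have e1 := dZ _ _ _ n (diffH Da).
have e2 := dZ _ _ _ n (diffDH u Da).
have e3 := dZ _ _ _ n (diffDH w Da).
rewrite /dpull !mulrDr; congr (_ + _ + _).
- by rewrite e1; exact: (dZ _ _ _ _ (gram_diff _ _ (ccodH Da))).
- by rewrite e2; exact: (innerZl iG).
- by rewrite e3; exact: (innerZr iG).
Qed.

Lemma is_derive_scale (v : E) (t : R) : is_derive t 1 (fun s : R => s *: v) v.
Proof.
have -> : (fun s : R => s *: v) = fun s => 0 + s *: v by apply/funext => s; rewrite add0r.
exact: is_derive_line.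
Qed.

Lemma near_ray a v (t : R) : D a (t *: v) -> \forall s \near t, D a (s *: v).
Proof.
move=> Da; have [dl _] := is_derive_scale v t.
exact: (derivable_cont dl (near_Exp_chart Da)).
Qed.

Lemma derive1_Exp_line a v (t : R) : D a (t *: v) ->
  derive1 (fun s => H a (s *: v)) t = 'D_v (H a) (t *: v).
Proof.
move=> Da; rewrite derive1E.
by case: (is_derive_comp (is_derive_scale v t) (diffH Da)).
Qed.

Lemma ray_ode a v (t : R) w : V v -> 0 < t < 1 -> D a (t *: v) ->
  gram a (H a (t *: v)) ('D_v (fun y => 'D_v (H a) y) (t *: v)) w =
  - christoffel1 a (H a (t *: v)) ('D_v (H a) (t *: v)) ('D_v (H a) (t *: v)) w.
Proof.
move=> Vv /andP[t0 t1] Da; have [c [[e e0 gc] _ _ cF]] := ray Vv.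
pose z := cmap (chart_of a) \o c.
have n01 : \forall s \near t, 0 < s < 1.
  have : nbhs t `]0, 1[%classic by apply: near_in_itvoo; rewrite in_itv /= t0.
  by apply: filterS => s; rewrite /= in_itv.
have E1 : \forall s \near t, z s = H a (s *: v).
  by apply: filterS n01 => s /andP[s0 s1]; rewrite /z /= cF // !ltW.
have ca : cdom (chart_of a) (c t) by rewrite cF ?ltW //; case: Da.
have It : `](- e), (1 + e)[%classic t by rewrite /= in_itv /=; apply/andP; split; lra.
have oI : open `](- e), (1 + e)[%classic by exact: interval_open.
have Sz := nbhs_singleton (geodesic_solves oI gc It ca).
have E2 : \forall s \near t, derive1 z s = 'D_v (H a) (s *: v).
  have nE1 : \forall s \near t, \forall r \near s, z r = H a (r *: v).
    exact: nbhs_interior.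
  apply: filterS2 nE1 (near_ray Da) => s h1 h2.
  rewrite -(derive1_Exp_line h2) !derive1E; exact: near_eq_derive.
have E3 : derive1 (derive1 z) t = 'D_v (fun y => 'D_v (H a) y) (t *: v).
  rewrite derive1E (near_eq_derive _ E2).
  by case: (is_derive_comp (is_derive_scale v t) (diffDH v Da)).
have := solves_christoffel1 w Sz.
by rewrite -/z E3 (nbhs_singleton E2) (nbhs_singleton E1).
Qed.

Lemma christoffel1_diag (a : atlas N) (y u w : E) : christoffel1 a y u u w =
  'D_u (fun z => gram a z u w) y - 2^-1 * 'D_w (fun z => gram a z u u) y.
Proof. by rewrite /christoffel1; field. Qed.

(** Along a radial geodesic the geodesic equation turns the derivative of the
    pull-back metric in the radial direction into half of a transverse
    derivative; second derivatives of the exponential map commute. *)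
Lemma dpull_radial a v (t : R) n : V v -> 0 < t < 1 -> D a (t *: v) ->
  dpull a (t *: v) v v n = 2^-1 * dpull a (t *: v) n v v.
Proof.
move=> Vv t01 Da; have iG := gram_inner (ccodH Da).
have ode := ray_ode ('D_n (H a) (t *: v)) Vv t01 Da; rewrite christoffel1_diag in ode.
have S := schwarz_mx n v (open_Exp_chart (a := a)) (CkH 2 a) Da.
have G4 := f_equal (fun X => gram a (H a (t *: v)) ('D_v (H a) (t *: v)) X) S.
have G3 := f_equal (fun X => gram a (H a (t *: v)) X ('D_v (H a) (t *: v))) S.
have G3' := etrans G3 (innerC iG _ _).
have alg (A B g1 g2 g3 g4 : R) : g1 = - (A - 2^-1 * B) -> g3 = g2 -> g4 = g2 ->
  A + g1 + g2 = 2^-1 * (B + g3 + g4) by move=> -> -> ->; field.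
exact (alg _ _ _ _ _ _ ode G3' G4).
Qed.

Lemma dpull_energy a v (t : R) : V v -> 0 < t < 1 -> D a (t *: v) ->
  dpull a (t *: v) v v v = 0.
Proof. by move=> Vv t01 Da; have := dpull_radial v Vv t01 Da; lra. Qed.

(** The pull-back metric without reference to a chart: along a ray one chart is
    not enough, and pull_chart lets any chart be used locally. *)
Definition gpull (xi u w : E) : R := pull (chart_at (F xi)) xi u w.

Lemma D_at xi : V xi -> D (chart_at (F xi)) xi.
Proof. by move=> Vx; split=> //; exact: chart_atP. Qed.

Lemma gpull_chart a xi u w : D a xi -> gpull xi u w = pull a xi u w.
Proof. by move=> Da; apply: pull_chart => //; case: Da => Vx _; exact: D_at. Qed.

Lemma is_derive_gpull a (xi : R -> E) (t : R) n u w : D a (xi t) -> is_derive t 1 xi n ->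
  is_derive t 1 (fun s => gpull (xi s) u w) (dpull a (xi t) n u w).
Proof.
move=> Da dxi.
have nD : \forall s \near t, D a (xi s).
  by case: dxi => dx _; exact: (derivable_cont dx (near_Exp_chart Da)).
have E1 : \forall s \near t, pull a (xi s) u w = gpull (xi s) u w.
  by apply: filterS nD => s Ds; rewrite (gpull_chart _ _ Ds).
exact: (near_eq_is_derive E1 (is_derive_pull _ _ Da dxi)).
Qed.

Lemma derivable_gpull (xi : R -> E) (t : R) n u w : V (xi t) -> is_derive t 1 xi n ->
  derivable (fun s => gpull (xi s) u w) t 1.
Proof. by move=> Vx dx; case: (is_derive_gpull u w (D_at Vx) dx). Qed.

Lemma gpull_quad xi v n (s : R) : V xi -> gpull xi (v + s *: n) (v + s *: n) =
  gpull xi v v + 2 * (s * gpull xi v n) + s * (s * gpull xi n n).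
Proof.
move=> Vx; rewrite /gpull; have [S Ll Lr] := pull_inner (D_at Vx).
rewrite (addrC v) Ll !Lr (S n v).
move: (pull _ _ v v) (pull _ _ v n) (pull _ _ n n) => A B C; ring.
Qed.

(** Geodesics have constant speed. *)
Lemma gpull_energy v (t : R) : V v -> 0 <= t <= 1 -> gpull (t *: v) v v = gpull 0 v v.
Proof.
move=> Vv /andP[t0 t1].
have dl s := is_derive_scale v s.
pose phi s := gpull (s *: v) v v.
have : phi t - phi 0 = 0 * (t - 0).
  apply: (@increment_constant_derivative _ phi 0 0 t t0).
- move=> s /andP[s0 st].
  have Vs : V (s *: v) by apply: starV => //; rewrite s0 (le_trans st).
  exact: (derivable_gpull Vs (dl s)).
- move=> s /andP[s0 st]; have s01 : 0 < s < 1 by rewrite s0 (lt_le_trans st).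
  have Vs : V (s *: v) by apply: starV => //; case/andP: s01 => ? ?; rewrite !ltW.
  have := is_derive_gpull v v (D_at Vs) (dl s).
  by rewrite (dpull_energy Vv s01 (D_at Vs)).
by rewrite /phi scale0r mul0r => /eqP; rewrite subr_eq0 => /eqP.
Qed.

(** Constancy of speed along the neighbouring rays of v + s n: both sides are the
    derivative at s = 0 of their common squared speed. *)
Lemma gpull_transverse a v n (t : R) : V v -> 0 < t < 1 -> D a (t *: v) ->
  t * dpull a (t *: v) n v v + 2 * gpull (t *: v) v n = 2 * gpull 0 v n.
Proof.
move=> Vv t01 Da; have [t0 t1] := andP t01.
pose xi (s : R) := t *: v + s *: (t *: n).
have dxi : is_derive (0 : R) 1 xi (t *: n) by exact: is_derive_line.
have xi0 : xi 0 = t *: v by rewrite /xi scale0r addr0.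
have Dxi : D a (xi 0) by rewrite xi0.
have Vxi : V (xi 0) by case: Dxi.
have d0 := is_derive_gpull v v Dxi dxi.
rewrite (dpull_linear _ _ _ _ Dxi) xi0 in d0.
have Q1 := is_derive_quadratic d0 (derivable_gpull (u := v) (w := n) Vxi dxi)
  (derivable_gpull (u := n) (w := n) Vxi dxi).
have Q2 := is_derive_quadratic (is_derive_cst (gpull 0 v v) (0 : R) 1)
  (derivable_cst (gpull 0 v n) (0 : R) 1) (derivable_cst (gpull 0 n n) (0 : R) 1).
have nV : \forall s \near (0 : R), V (v + s *: n).
  have [dl _] := is_derive_line v n (0 : R).
  by apply: (derivable_cont dl); rewrite scale0r addr0; apply: open_nbhs_nbhs.
have E1 : \forall s \near (0 : R),
   gpull 0 v v + 2 * (s * gpull 0 v n) + s * (s * gpull 0 n n) =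
   gpull (xi s) v v + 2 * (s * gpull (xi s) v n) + s * (s * gpull (xi s) n n).
  apply: filterS nV => s Vs.
  have xiE : xi s = t *: (v + s *: n) by rewrite /xi scalerDr !scalerA mulrC.
  have t01' : 0 <= t <= 1 by rewrite !ltW.
  have Vxis : V (xi s) by rewrite xiE; exact: starV.
  have e := gpull_energy Vs t01'; rewrite -xiE in e.
  exact (etrans (esym (gpull_quad v n s V0)) (etrans (esym e) (gpull_quad v n s Vxis))).
have Q3 := near_eq_is_derive E1 Q2.
case: Q1 => _ Q1; case: Q3 => _; rewrite Q1 xi0 add0r; exact.
Qed.

(** By dpull_radial and gpull_transverse, t * gpull (t v) v n has the constant
    derivative gpull 0 v n on ]0, 1[; it vanishes at t = 0. *)
Lemma gpull_radial v n : V v -> gpull v v n = gpull 0 v n.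
Proof.
move=> Vv; have dl s := is_derive_scale v s.
have Vs s : 0 <= s <= 1 -> V (s *: v) by exact: starV.
have dM (s u : R) : 0 <= s <= 1 -> is_derive s 1 (fun r => gpull (r *: v) v n) u ->
    is_derive s 1 (fun r => r * gpull (r *: v) v n) (gpull (s *: v) v n + s * u).
  move=> s01 du; have := is_deriveM (is_derive_id s 1) du.
  by rewrite /GRing.scale /= mulr1 addrC.
pose phi s := s * gpull (s *: v) v n.
have : phi 1 - phi 0 = gpull 0 v n * (1 - 0).
  apply: (@increment_constant_derivative _ phi _ 0 1 ler01).
- move=> s s01; have := derivable_gpull (u := v) (w := n) (Vs _ s01) (dl s).
  by move=> /derivableP /(dM _ _ s01) [].
- move=> s s01; have s01' : 0 <= s <= 1 by case/andP: s01 => ? ?; rewrite !ltW.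
  have Da := D_at (Vs _ s01').
  have := dM _ _ s01' (is_derive_gpull v n Da (dl s)).
  rewrite (dpull_radial n Vv s01 Da).
  have := gpull_transverse n Vv s01 Da.
  move: (dpull _ _ _ _ _) (gpull (s *: v) v n) => A B E.
  have -> : B + s * (2^-1 * A) = gpull 0 v n by lra.
  by [].
by rewrite /phi scale1r mul1r mul0r !subr0 mulr1.
Qed.

Lemma Exp0 : F 0 = p.
Proof.
have [c [_ c0 _ cF]] := ray V0.
have E0 : c 0 = F 0 by rewrite cF ?lexx ?ler01 // scale0r.
by rewrite -E0.
Qed.

(** In the direction of a small vector v, the curve s |-> Exp (s v) is a geodesic
    of initial velocity v; other directions follow by linearity. *)
Lemma dExp0 u : 'D_u (coord p \o F) 0 = u.
Proof.
have Da : D (chart_at p) 0 by have := D_at V0; rewrite Exp0.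
have small v : V v -> 'D_v (H (chart_at p)) 0 = v.
  move=> Vv; have [c [gc c0 vc cF]] := ray Vv.
  have Da0 : D (chart_at p) (0 *: v) by rewrite scale0r.
  have I0 : 0 <= (0 : R) <= 1 by rewrite lexx ler01.
  rewrite -(scale0r v) -(derive1_Exp_line Da0) -[RHS]vc /velocity c0.
  have dH : derivable (fun s : R => H (chart_at p) (s *: v)) 0 1.
    by case: (is_derive_comp (is_derive_scale v 0) (diffH Da0)).
  have dc : derivable (coord p \o c) 0 1.
    by apply: (geodesic_derivable gc I0); rewrite c0; exact: chart_atP.
  apply: (derive1_eq_right ltr01 dH dc) => s /andP[s0 s1].
  by rewrite /H /= cF // s0 ltW // -[1]add0r.
have [dl _] := is_derive_scale u (0 : R).
have nV : nbhs (0 *: u) V by rewrite scale0r; apply: open_nbhs_nbhs.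
have /nbhs_ballP [r /= r0 Hr] : \forall s \near (0 : R), V (s *: u).
  exact: (derivable_cont dl nV).
have Vr : V ((r / 2) *: u).
  apply: Hr; rewrite -ball_normE /ball_ /= sub0r normrN ger0_norm ?divr_ge0 ?ltW //.
  by rewrite ltr_pdivrMr // mulr2n mulrDr mulr1 ltrDl.
have rn0 : r / 2 != 0 by rewrite gt_eqF // divr_gt0.
have := small _ Vr; rewrite !(deriveE _ (diffH Da)) linearZ /= -(deriveE _ (diffH Da)).
exact: (scalerI rn0).
Qed.

Lemma gpull0 u w : gpull 0 u w = metric (u : tangent p) w.
Proof. by rewrite /gpull Exp0 /pull /H !dExp0 /metric /= Exp0. Qed.

Lemma velocity_ray_end v c : V v -> geodesic c -> c 0 = p -> velocity c 0 = v :> E ->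
  velocity c 1 = 'D_v (coord (F v) \o F) v :> E.
Proof.
move=> Vv gc c0 vc; have [_ c1 _] := ray_joins Vv gc c0 vc.
have Da : D (chart_at (F v)) (1 *: v) by rewrite scale1r; exact: D_at.
have I1 : 0 <= (1 : R) <= 1 by rewrite lexx ler01.
rewrite /velocity c1 -[X in _ = derive _ X _]scale1r -(derive1_Exp_line Da).
have dH : derivable (fun s : R => H (chart_at (F v)) (s *: v)) 1 1.
  by case: (is_derive_comp (is_derive_scale v 1) (diffH Da)).
have dc : derivable (coord (F v) \o c) 1 1.
  by apply: (geodesic_derivable gc I1); rewrite c1; exact: chart_atP.
apply: (derive1_eq_left ltr01 dc dH) => s /andP[s0 s1].
rewrite /H /= (Exp_ray gc c0 vc) // s1 andbT ltW //.
by move: s0; rewrite subrr.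
Qed.

(** The Gauss lemma, for a radial vector and an arbitrary one. *)
Lemma gauss v c n : V v -> geodesic c -> c 0 = p -> velocity c 0 = v :> E ->
  metric ('D_n (coord (F v) \o F) v : tangent (F v)) (velocity c 1) =
  metric (n : tangent p) v.
Proof.
move=> Vv gc c0 vc; rewrite (velocity_ray_end Vv gc c0 vc) -gpull0.
have [S0 _ _] := pull_inner (D_at V0); have [S _ _] := pull_inner (D_at Vv).
rewrite /gpull S0; have := gpull_radial n Vv; rewrite /gpull => <-.
by rewrite S.
Qed.

End logarithm.

(** * The gradient on one manifold *)

Section quadratic_form.
Context {R : realType} {m d : nat}.
Notation E := 'M[R]_(m, d).

Lemma differentiable_bigsum (I : finType) (V W : normedModType R) (f : I -> V -> W) x :
  (forall i, differentiable (f i) x) -> differentiable (fun s => \sum_i f i s) x.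
Proof.
move=> H; have -> : (fun s => \sum_i f i s) = \sum_i f i.
  by apply/funext => s; rewrite fct_sumE.
elim/big_ind : _; [exact: differentiable_cst|by move=> *; exact: differentiableD|by move=> i _; exact: H].
Qed.

Lemma differential_quadratic (B : E -> E -> R) (S : {linear E -> E}) u :
  inner_product B -> (forall v w, B (S v) w = B v (S w)) ->
  differentiable (fun w => B (S w) w) u /\
  forall v, 'D_v (fun w => B (S w) w) u = 2 * B (S u) v.
Proof.
move=> iB sa.
pose l K (w : E) : R^o := B (S w) (elem K).
have ll K : linear (l K).
  by move=> k v w; rewrite /l linearP (innerDl iB) (innerZl iB).
pose lL K : {linear E -> R^o} := HB.pack (l K)
  (GRing.isLinear.Build R E R^o *:%R (l K) (ll K)).
have dl K w : differentiable (lL K : E -> R) w by exact: linear_mx_differentiable.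
have Dl K w v : 'D_v (lL K : E -> R) w = lL K v by exact: derive_linear_mx.
have -> : (fun w => B (S w) w) = fun w => \sum_K entry w K * lL K w.
  by apply/funext => w; exact: inner_entryr.
split.
  apply: differentiable_bigsum => K.
  exact: (differentiableM (differentiable_entry K u) (dl K u)).
move=> v.
have D : is_derive u v (fun w => \sum_K entry w K * lL K w)
    (\sum_K (entry u K * lL K v + lL K u * entry v K)).
  apply: is_derive_bigsum => K.
  apply: (is_deriveM (f := fun w => entry w K) (g := lL K : E -> R)).
    exact: (is_derive_entry K (is_derive_id u v)).
  by rewrite -(Dl K u v); apply: derivableP; apply: diff_derivable; exact: dl.
case: D => _ ->; rewrite big_split /=.
have -> : \sum_K entry u K * lL K v = B (S u) v.
  by rewrite sa (innerC iB u) (inner_entryr iB).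
have -> : \sum_K lL K u * entry v K = B (S u) v.
  by rewrite (inner_entryr iB); apply: eq_bigr => K _; rewrite mulrC.
by rewrite mulr2n mulrDl mul1r.
Qed.

End quadratic_form.

Section mahalanobis.
Context {R : realType} {m d : nat} {N : riemannian 'M[R]_(m, d)}.
Notation E := 'M[R]_(m, d).

Lemma metric_inner (x : N) : inner_product (@metric R E N x).
Proof. by apply: gram_inner; apply: cmap_cod; exact: chart_atP. Qed.

Lemma diff_linear (V W : normedModType R) (f : V -> W) x : linear ('d f x).
Proof. by move=> k u v; rewrite linearP. Qed.

(** The statement for one manifold. The differential of f at x is
    2 g (S ell, d ell .) with ell = Log x, as S is self-adjoint. For the second
    formula put xi = W ell, so that k x = Exp xi; Log at k x of mu is minus the
    final velocity of the ray of xi, and the Gauss lemma moves the scalar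
    product at k x back to mu, where it is g (W d ell ., W ell) =
    g (d ell ., S ell). *)
Theorem gradient_squared_norm_log (U : set N) (mu : N) (S W : {linear tangent mu -> tangent mu})
    (f : N -> R) (x : N) :
  open U -> unique_joins U -> normal_neighborhood mu U ->
  (forall u v : tangent mu, metric (S u) v = metric u (S v)) ->
  (forall v : tangent mu, adjoint W (W v) = S v) ->
  (forall y, U y -> f y = metric (S (Log U mu y)) (Log U mu y)) -> U x ->
  [/\ differentiable_vec (Log U mu) x,
      differentiable_vec f x &
      grad f x = 2 *: adjoint (diff_vec (Log U mu) x) (S (Log U mu x))] /\
  (forall k : N -> N,
     (forall y, U y -> k y = Exp (W (Log U mu y))) ->
     (exists2 y, U y & Log U mu y = W (Log U mu x)) ->
     differentiable_map k x /\
     grad f x = - 2 *: adjoint (diff_map k x) (Log U (k x) mu)).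
Proof.
move=> oU uU [V [L [[oV V0 starV VExp] HVU HUV sExp sL]]] sa WtW hf Ux.
have ExpU v (Vv : V v) := (HVU v Vv).1.
have logE := LogE uU starV VExp ExpU HUV.
pose a := chart_at x; pose y0 := coord x x.
have ax : cdom (chart_of a) x by exact: chart_atP.
have y0c : ccod (chart_of a) y0 by exact: cmap_cod.
have invy0 : cinv (chart_of a) y0 = x by exact: cmapK.
have nU : nbhs x U by exact: open_nbhs_nbhs.
have nUy : \forall y \near y0, U (cinv (chart_of a) y).
  by apply: (cinv_cont y0c); rewrite invy0.
pose ell : E -> E := Log U mu \o cinv (chart_of a).
have ellx : ell y0 = Log U mu x by rewrite /ell /= invy0.
have dell : differentiable ell y0.
  have d1 : differentiable (L \o cinv (chart_of a)) y0.
    by apply: (sL a 1).1; exists x.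
  apply: (near_diff _ d1).1; apply: filterS nUy => y Uy.
  by rewrite /ell /= logE.
pose dl : E -> E := 'd ell y0.
have iM := metric_inner mu; have iX := metric_inner x.
pose Q : E -> R := fun w => metric (S w : tangent mu) w.
have [dQ DQ] := differential_quadratic (Log U mu x) iM sa.
have df : differentiable (f \o cinv (chart_of a)) y0 /\
    'd (f \o cinv (chart_of a)) y0 =
    (fun v => 2 * metric (S (Log U mu x) : tangent mu) (dl v)) :> (E -> R).
  have dQ' : differentiable Q (ell y0) by rewrite ellx.
  have dc := differentiable_comp dell dQ'.
  have E1 : \forall y \near y0, (Q \o ell) y = (f \o cinv (chart_of a)) y.
    by apply: filterS nUy => y Uy; rewrite /= hf.
  have [df ->] := near_diff E1 dc; split=> //.
  apply/funext => v; rewrite (diff_comp dell dQ') -DQ (deriveE _ dQ) -ellx.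
  by [].
have gradE (g : E) : (forall w, metric (g : tangent x) w =
    2 * metric (S (Log U mu x) : tangent mu) (dl w)) -> grad f x = g.
  by move=> H; apply: (sharp_eq iX) => w; rewrite H /diff_vec df.2.
have linB (y : N) (F : E -> E) (w : E) : linear F ->
    linear ((fun v => metric (F v : tangent y) w) : E -> R^o).
  move=> lF k u v; rewrite lF; have iY := metric_inner y.
  by rewrite (innerDl iY) (innerZl iY).
split.
  split; [exact: dell|exact: df.1|].
  apply: gradE => w; rewrite (innerZl iX) (sharpP iX); last first.
    by apply: (linB mu dl); exact: diff_linear.
  by rewrite (innerC iM).
move=> k kE [y1 Uy1 y1E].
pose xi : E := W (Log U mu x).
have Vxi : V xi by rewrite /xi -y1E logE //; exact: (HUV _ Uy1).1.
have kx : k x = Exp (xi : tangent mu) by exact: kE.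
have cW : continuous (W : E -> E) by exact: linear_mx_continuous.
have dW u : differentiable (W : E -> E) u by exact: linear_mx_differentiable.
have DW u v : 'D_v (W : E -> E) u = W v by exact: derive_linear_mx.
have ck : {for x, continuous k}.
  have E1 : \forall y \near x, Exp (W (ell (cmap (chart_of a) y)) : tangent mu) = k y.
    have na : nbhs x (cdom (chart_of a)).
      by apply: open_nbhs_nbhs; split=> //; exact: cdom_open.
    apply: filterS2 nU na => y Uy ay.
    by rewrite kE // /ell /= cmapK.
  have c1 : {for x, continuous (fun y => Exp (W (ell (cmap (chart_of a) y)) : tangent mu))}.
    have c2 : {for x, continuous (ell \o cmap (chart_of a))}.
      apply: continuous_comp; first exact: cmap_cont.
      exact: differentiable_continuous.
    have c3 : {for x, continuous ((W : E -> E) \o (ell \o cmap (chart_of a)))}.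
      apply: continuous_comp; first exact: c2.
      exact: cW.
    apply: (continuous_comp (f := (W : E -> E) \o (ell \o cmap (chart_of a)))
      (g := @Exp R E N mu)); first exact: c3.
    by apply: sExp.1; rewrite /= -/(coord x x) -/y0 ellx.
  have E0 := nbhs_singleton E1.
  have c1' : Exp (W (ell (cmap (chart_of a) y)) : tangent mu) @[y --> x] --> k x.
    by rewrite -E0; exact: c1.
  by apply: cvg_trans c1'; exact: near_eq_cvg.
pose H : E -> E := coord (Exp (xi : tangent mu)) \o @Exp R E N mu.
have dH : differentiable H xi.
  exact: (diffH sExp (D_at Vxi)).
have dWl : differentiable ((W : E -> E) \o ell) y0 by exact: (differentiable_comp dell (dW _)).
have WlE : ((W : E -> E) \o ell) y0 = xi by rewrite /= ellx.
have dk : differentiable (coord (k x) \o k \o cinv (chart_of a)) y0 /\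
    'd (coord (k x) \o k \o cinv (chart_of a)) y0 =
    (fun v => 'D_(W (dl v)) H xi) :> (E -> E).
  have dH' : differentiable H (((W : E -> E) \o ell) y0) by rewrite WlE.
  have dc := differentiable_comp dWl dH'.
  have dWlE v : 'd ((W : E -> E) \o ell) y0 v = W (dl v).
    rewrite -(deriveE v dWl) (derive_comp v dell (dW _)) DW.
    by rewrite (deriveE v dell).
  have E1 : \forall y \near y0, (H \o ((W : E -> E) \o ell)) y =
      (coord (k x) \o k \o cinv (chart_of a)) y.
    by apply: filterS nUy => y Uy; rewrite /= kx kE.
  have [dk ->] := near_diff E1 dc; split=> //.
  apply/funext => v; rewrite (diff_comp dWl dH') (deriveE _ dH) -dWlE -WlE.
  by [].
split; first by split=> //; exact: dk.1.
have [c [gc c0 vc _]] := ray VExp Vxi.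
have LB := Log_back uU starV ExpU Vxi gc c0 vc.
have G n := gauss oV V0 starV VExp ExpU sExp n Vxi gc c0 vc.
have WW u v : metric (W u) (W v) = metric u (S v).
  rewrite (innerC iM u) -WtW (sharpP iM) //; apply: (linB mu W).
  by move=> r w z; rewrite linearP.
have iK := metric_inner (Exp (xi : tangent mu)).
apply: gradE => w; rewrite (innerZl iX) (sharpP iX).
  rewrite /diff_map /diff_vec dk.2.
  have -> : metric ('D_(W (dl w)) H xi : tangent (k x)) (Log U (k x) mu) =
      - metric (dl w : tangent mu) (S (Log U mu x)).
    by rewrite kx LB (innerNr iK) G -WW.
  by rewrite mulrNN (innerC iM).
by apply: linB; exact: diff_linear.
Qed.

End mahalanobis.

(** * Power manifolds *)

Section rows.
Context {R : realType} {n d : nat}.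

Lemma derivable_rowP (V : normedModType R) (z : V -> 'M[R]_(n, d)) t v :
  derivable z t v <-> forall i, derivable (fun s => row i (z s)) t v.
Proof.
split=> [/derivable_mxP dz i|dz].
  apply/derivable_mxP => k j; under eq_fun do rewrite mxE; exact: dz.
apply/derivable_mxP => i j.
have /derivable_mxP/(_ 0 j) := dz i.
by under eq_fun do rewrite mxE.
Qed.

Lemma row_derive1 (z : R -> 'M[R]_(n, d)) (t : R) i : derivable z t 1 ->
  row i (derive1 z t) = derive1 (fun s => row i (z s)) t.
Proof.
move=> dz; have dr := (derivable_rowP _ _ _).1 dz i.
rewrite !derive1E (derive_mx dz) (derive_mx dr); apply/rowP => j; rewrite !mxE.
by under [in RHS]eq_fun do rewrite mxE.
Qed.

Lemma row_diff (i : 'I_n) (y : 'M[R]_(n, d)) : differentiable (row i : 'M[R]_(n, d) -> 'rV[R]_d) y.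
Proof.
pose L : {linear 'M[R]_(n, d) -> 'rV[R]_d} := row i.
exact: (linear_mx_differentiable L).
Qed.

Lemma derive_row (W : normedModType R) (g : 'rV[R]_d -> W) i (y u : 'M[R]_(n, d)) :
  differentiable g (row i y) -> 'D_u (fun z => g (row i z)) y = 'D_(row i u) g (row i y).
Proof.
move=> dg; pose L : {linear 'M[R]_(n, d) -> 'rV[R]_d} := row i.
rewrite (derive_comp u (row_diff i y) dg).
by rewrite (derive_linear_mx L).
Qed.

End rows.

Section power_geometry.
Context {R : realType} {d : nat} (M : riemannian 'rV[R]_d) (n : nat).
Notation P := (power M n).
Implicit Types (A : atlas P) (c : R -> P) (y u v w : 'M[R]_(n, d)).

Lemma christoffel1_power A y u v w : ccod (chart_of A) y ->
  christoffel1 A y u v w =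
  \sum_i christoffel1 (A i : atlas M) (row i y) (row i u) (row i v) (row i w).
Proof.
move=> Ay.
have E1 a b e : 'D_a (fun z => gram A z b e) y =
    \sum_i 'D_(row i a) (fun z => gram (A i : atlas M) z (row i b) (row i e)) (row i y).
  have dg i : differentiable (fun z => gram (A i : atlas M) z (row i b) (row i e)) (row i y).
    by apply: gram_diff; exact: Ay.
  have D : is_derive y a (fun z => \sum_i gram (A i : atlas M) (row i z) (row i b) (row i e))
      (\sum_i 'D_(row i a) (fun z => gram (A i : atlas M) z (row i b) (row i e)) (row i y)).
    apply: is_derive_bigsum => i; rewrite -(derive_row a (dg i)); apply: derivableP.
    apply: diff_derivable.
    exact: (differentiable_comp (row_diff i y) (dg i)).
  by case: D.
by rewrite /christoffel1 !E1 -big_split -sumrB mulr_sumr.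
Qed.

(** The metric of the power is a sum over the factors, so the vector whose rows
    are the Christoffel symbols of the factors represents the right form. *)
Lemma row_christoffel_power A y u v i : ccod (chart_of A) y ->
  row i (christoffel A y u v) =
  christoffel (A i : atlas M) (row i y) (row i u) (row i v).
Proof.
move=> Ay.
pose C : 'M[R]_(n, d) := \matrix_(k, j)
  christoffel (A k : atlas M) (row k y) (row k u) (row k v) 0 j.
have rC k : row k C = christoffel (A k : atlas M) (row k y) (row k u) (row k v).
  by apply/rowP => j; rewrite !mxE.
have -> : christoffel A y u v = C; last exact: rC.
apply: (sharp_eq (gram_inner Ay)) => w; rewrite christoffel1_power //.
apply: eq_bigr => k _; rewrite rC gram_christoffel //; exact: Ay.
Qed.

Lemma solves_row A (z : R -> 'M[R]_(n, d)) (t : R) i :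
  (\forall s \near t, solves A z s) -> solves (A i : atlas M) (fun s => row i (z s)) t.
Proof.
move=> nz; have [Oz dz ddz ode] := nbhs_singleton nz.
have E1 : \forall s \near t, row i (derive1 z s) = derive1 (fun s => row i (z s)) s.
  by apply: filterS nz => s [_ ds _ _]; exact: row_derive1.
have dr := (derivable_rowP _ _ _).1 dz i.
have ddr := (derivable_rowP _ _ _).1 ddz i.
split.
- exact: Oz.
- exact: dr.
- exact: (near_eq_derivable E1 ddr).
have E2 : derive1 (derive1 (fun s => row i (z s))) t = row i (derive1 (derive1 z) t).
  by rewrite (row_derive1 _ ddz) derive1E -(near_eq_derive _ E1) -derive1E.
rewrite E2 -(nbhs_singleton E1) -row_christoffel_power // -linearD ode.
by rewrite linear0.
Qed.

Lemma rows_solve A (z : R -> 'M[R]_(n, d)) (t : R) :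
  (forall i, \forall s \near t, solves (A i : atlas M) (fun s => row i (z s)) s) ->
  solves A z t.
Proof.
move=> nz.
have dz : \forall s \near t, derivable z s 1.
  have H : nbhs t [set s : R | forall i, solves (A i : atlas M) (fun s => row i (z s)) s].
    by apply: (@filter_forall _ _ _ _ (nbhs_filter t)) => i; exact: nz.
  apply: filterS H => s Hs; apply/derivable_rowP => i.
  by have [_ d1 _ _] := Hs i; exact: d1.
have E1 i : \forall s \near t, derive1 (fun s => row i (z s)) s = row i (derive1 z s).
  by apply: filterS dz => s ds; rewrite row_derive1.
have S i := nbhs_singleton (nz i).
have ddz : derivable (derive1 z) t 1.
  apply/derivable_rowP => i; have [_ _ dd _] := S i.
  exact: (near_eq_derivable (E1 i) dd).
have Oz : ccod (chart_of A) (z t) by move=> i; have [] := S i.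
split.
- exact: Oz.
- exact: nbhs_singleton dz.
- exact: ddz.
apply/row_matrixP => i; have rD (X Y : 'M[R]_(n, d)) : row i (X + Y) = row i X + row i Y by exact: linearD.
rewrite rD (row_christoffel_power _ _ _ Oz) row0.
have [_ _ _ ode] := S i.
have e2 : derive1 (derive1 (fun s => row i (z s))) t = row i (derive1 (derive1 z) t).
  by rewrite (row_derive1 i ddz) !derive1E (near_eq_derive _ (E1 i)).
by rewrite (nbhs_singleton (E1 i)) e2 in ode.
Qed.

Lemma row_chart A c i : (fun s => row i ((cmap (chart_of A) \o c) s)) =
  cmap (chart_of (A i : atlas M)) \o (fun s => c s i).
Proof. by apply/funext => s; rewrite /= row_power_map. Qed.

(** A chart of the factor around c t i extends to a product chart around c t. *)
Lemma geodesic_on_component (I : set R) c i : open I -> geodesic_on I c ->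
  geodesic_on I (fun t => c t i : M).
Proof.
move=> oI gc t It; have [cc _] := gc t It; split.
  apply: (continuous_comp (f := c) (g := fun x : P => x i : M)) => //.
  exact: power_proj_cont.
move=> b bc; pose A : atlas P := fun j => if j == i then b else chart_at (c t j).
have Ac : cdom (chart_of A) (c t).
  by move=> j; rewrite /A; case: eqP => [->|_] //; exact: chart_atP.
have := solves_row i (geodesic_solves oI gc It Ac).
have Ai : A i = b by rewrite /A eqxx.
rewrite row_chart Ai => -[_ d1 d2 d3].
by split; [exact: d1|exact: d2|exact: d3].
Qed.

Lemma geodesic_on_power (I : set R) c : open I ->
  (forall i, geodesic_on I (fun t => c t i : M)) -> geodesic_on I c.
Proof.
move=> oI gc t It; split.
  by apply: power_cont_at => i; exact: (gc i t It).1.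
move=> A Ac.
have H : solves A (cmap (chart_of A) \o c) t.
  apply: rows_solve => i; rewrite row_chart.
  exact: (geodesic_solves oI (gc i) It (Ac i)).
case: H => _ d1 d2 d3.
by split; [exact: d1|exact: d2|exact: d3].
Qed.

Lemma geodesic_component c i : geodesic c -> geodesic (fun t => c t i : M).
Proof.
by case=> e e0 gc; exists e => //; apply: geodesic_on_component => //; exact: interval_open.
Qed.

(** The domains of the finitely many components contain a common interval. *)
Lemma geodesic_power c : (forall i, geodesic (fun t => c t i : M)) -> geodesic c.
Proof.
move=> gc.
have /choice [e He] : forall i, exists e : R, 0 < e /\ geodesic_on `](- e), (1 + e)[%classic (fun t => c t i : M).
  by move=> i; have [e e0 ge] := gc i; exists e.
have : \forall r \near 0^'+, forall i, r < e i.
  apply: (@filter_forall _ _ _ _ (at_right_proper_filter (0 : R))) => i.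
  exact: nbhs_right_lt (He i).1.
have : \forall r \near (0 : R)^'+, 0 < r by exact: nbhs_right_gt.
move=> /filterI h /h /filter_ex [r [r0 rlt]].
exists r => //; apply: geodesic_on_power; first exact: interval_open.
move=> i; apply: (geodesic_on_sub _ (He i).2) => t.
rewrite /= !in_itv /= => /andP[t1 t2]; have := rlt i => ri.
by apply/andP; split; lra.
Qed.

Lemma row_velocity c (t : R) i : geodesic c -> 0 <= t <= 1 ->
  row i (velocity c t) = velocity (fun s => c s i : M) t.
Proof.
move=> gc t01; have dc := geodesic_derivable gc t01 (chart_atP (c t)).
by rewrite /velocity (row_derive1 _ dc) row_chart.
Qed.

Lemma power_unique_joins (U : set M) : unique_joins U -> unique_joins (power_set U n).
Proof.
move=> uU p q c c' gc [c0 c1 cU] gc' [c'0 c'1 c'U] t t01.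
apply/funext => i.
apply: (uU (p i) (q i) _ _ (geodesic_component i gc) _ (geodesic_component i gc')) => //.
  by split; [rewrite c0|rewrite c1|move=> s s01; exact: cU].
by split; [rewrite c'0|rewrite c'1|move=> s s01; exact: c'U].
Qed.

Lemma power_Exp (p : P) (v : tangent p) :
  (forall i, @Exp_dom R _ M (p i) (row i v)) ->
  @Exp_dom R _ P p v /\ Exp v = (fun i => Exp (row i v : tangent (p i))) :> P.
Proof.
move=> dv.
have /choice [c0 Hc] : forall i, exists ci : R -> M,
    [/\ geodesic ci, ci 0 = p i & velocity ci 0 = row i v :> 'rV[R]_d].
  by move=> i; have [q [ci [? ? ? _]]] := dv i; exists ci.
pose c : R -> P := fun t i => c0 i t.
have gc : geodesic c by apply: geodesic_power => i; have [] := Hc i.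
have cp : c 0 = p by apply/funext => i; have [] := Hc i.
have vc : velocity c 0 = v :> 'M[R]_(n, d).
  apply/row_matrixP => i; rewrite row_velocity //; last by rewrite lexx ler01.
  by have [] := Hc i.
split; first by exists (c 1), c.
rewrite (Exp_eq gc cp vc); apply/funext => i; have [g0 p0 v0] := Hc i.
by rewrite (@Exp_eq _ _ _ M (p i) (row i v) _ g0 p0 v0).
Qed.

Lemma open_chart_image (U : set M) (a : atlas M) : open U ->
  open (cmap (chart_of a) @` (U `&` cdom (chart_of a))).
Proof.
move=> oU; rewrite openE => _ [p [Up ap] <-].
have ay : ccod (chart_of a) (cmap (chart_of a) p) by exact: cmap_cod.
have nU : \forall y \near cmap (chart_of a) p, U (cinv (chart_of a) y).
  by apply: (cinv_cont ay); rewrite cmapK //; exact: open_nbhs_nbhs.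
apply: filterS2 nU (near_ccod ay) => y Uy cy.
exists (cinv (chart_of a) y); last exact: cinvK.
by split=> //; exact: cinv_dom.
Qed.

(** Exp and Log are computed componentwise, so products of the star-shaped sets
    and of the inverse maps of the factors work. *)
Lemma power_normal_neighborhood (U : set M) (mu : P) : open U ->
  (forall i, normal_neighborhood (mu i) U) -> normal_neighborhood mu (power_set U n).
Proof.
move=> oU nU.
have /choice [V HV] : forall i, exists Vi : set 'rV[R]_d, exists L : M -> 'rV[R]_d,
   [/\ [/\ open Vi, Vi 0, (forall (v : 'rV[R]_d) (t : R), Vi v -> 0 <= t <= 1 -> Vi (t *: v)) &
          Vi `<=` @Exp_dom R _ M (mu i)],
      (forall v : 'rV[R]_d, Vi v -> U (Exp (v : tangent (mu i))) /\ L (Exp (v : tangent (mu i))) = v),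
      (forall q, U q -> Vi (L q) /\ Exp (L q : tangent (mu i)) = q),
      smooth_into Vi (@Exp R _ M (mu i)) & smooth_from U L].
  by move=> i; have [Vi [L H]] := nU i; exists Vi, L.
have {HV} /choice [L HL] := HV.
pose VV : set 'M[R]_(n, d) := [set v | forall i, V i (row i v)].
pose LL (y : P) : 'M[R]_(n, d) := \matrix_(i, j) L i (y i) 0 j.
have rowLL (y : P) i : row i (LL y) = L i (y i) by apply/rowP => j; rewrite !mxE.
have ExpE v : VV v -> @Exp_dom R _ P mu v /\
    Exp (v : tangent mu) = (fun i => Exp (row i v : tangent (mu i))) :> P.
  by move=> Vv; apply: power_Exp => i; have [[_ _ _ H] _ _ _ _] := HL i; exact: H.
have oV : open VV by apply: open_row_box => i; have [[]] := HL i.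
exists VV, LL; split.
- split=> //.
  + by move=> i; rewrite row0; have [[]] := HL i.
  + move=> v t Vv t01 i; rewrite linearZ /=; have [[_ _ H _] _ _ _ _] := HL i.
    by apply: H => //; exact: Vv.
  + by move=> v /ExpE [].
- move=> v Vv; rewrite (ExpE v Vv).2; split=> [i|].
    by have [_ H _ _ _] := HL i; exact: (H _ (Vv i)).1.
  apply/row_matrixP => i; rewrite rowLL.
  by have [_ H _ _ _] := HL i; exact: (H _ (Vv i)).2.
- move=> q Uq; have VL : VV (LL q).
    by move=> i; rewrite rowLL; have [_ _ H _ _] := HL i; exact: (H _ (Uq i)).1.
  split=> //; rewrite (ExpE _ VL).2; apply/funext => i; rewrite rowLL.
  by have [_ _ H _ _] := HL i; exact: (H _ (Uq i)).2.
- split=> [v Vv|A k].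
    apply: power_cont_at => i; have [_ _ _ [cE _] _] := HL i.
    have E1 : \forall u \near v, Exp (row i u : tangent (mu i)) =
        (Exp (u : tangent mu) : P) i.
      have nV : nbhs v VV by exact: open_nbhs_nbhs.
      by apply: filterS nV => u Vu; rewrite (ExpE u Vu).2.
    have c1 : {for v, continuous (fun u : 'M[R]_(n, d) => Exp (row i u : tangent (mu i)))}.
      apply: (continuous_comp (f := row i) (g := @Exp R _ M (mu i))); first exact: row_cont.
      exact: cE (Vv i).
    have c2 : Exp (row i u : tangent (mu i)) @[u --> v] --> (Exp (v : tangent mu) : P) i.
      by rewrite -(nbhs_singleton E1); exact: c1.
    apply: cvg_trans c2.
    exact: (@near_eq_cvg _ _ (nbhs v) (nbhs_filter v) _ _ E1).
  pose O i := V i `&` @Exp R _ M (mu i) @^-1` cdom (chart_of (A i : atlas M)).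
  have oO i : open (O i).
    have [[oVi _ _ _] _ _ sE _] := HL i.
    exact: (open_Exp_chart oVi sE).
  have SE : VV `&` @Exp R _ P mu @^-1` cdom (chart_of A) = [set v | forall i, O i (row i v)].
    apply/seteqP; split=> [v [Vv Av] i|v Ov].
      by split; [exact: Vv|have := Av i; rewrite (ExpE v Vv).2].
    have Vv : VV v by move=> i; exact: (Ov i).1.
    by split=> // i; rewrite (ExpE v Vv).2; exact: (Ov i).2.
  rewrite SE.
  have CB : Ck k [set v | forall i, O i (row i v)]
      (blk (fun i => cmap (chart_of (A i : atlas M)) \o @Exp R _ M (mu i))).
    by apply: Ck_blk => // i; have [_ _ _ [_ sE] _] := HL i; exact: sE.
  apply: (Ck_ext (open_row_box oO) _ CB) => v Ov.
  have Vv : VV v by move=> i; exact: (Ov i).1.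
  by rewrite /= (ExpE v Vv).2; apply/matrixP => i j; rewrite !mxE.
- move=> A k.
  pose O i := cmap (chart_of (A i : atlas M)) @` (U `&` cdom (chart_of (A i : atlas M))).
  have -> : cmap (chart_of A) @` (power_set U n `&` cdom (chart_of A)) =
      [set y | forall i, O i (row i y)].
    apply/seteqP; split=> [_ [x [Ux Ax] <-] i|y Oy].
      by exists (x i); [split; [exact: Ux|exact: Ax]|rewrite row_power_map].
    have /choice [x Hx] : forall i, exists q : M, [/\ U q, cdom (chart_of (A i : atlas M)) q
        & cmap (chart_of (A i : atlas M)) q = row i y].
      by move=> i; have [q [? ?] ?] := Oy i; exists q.
    exists x; first by split=> i; have [] := Hx i.
    by apply/row_matrixP => i; rewrite row_power_map; have [] := Hx i.
  have -> : LL \o cinv (chart_of A) = blk (fun i => L i \o cinv (chart_of (A i : atlas M))).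
    by apply/funext => y; apply/matrixP => i j; rewrite !mxE.
  apply: Ck_blk => i; first exact: open_chart_image.
  by have [_ _ _ _ sL] := HL i; exact: sL.
Qed.

End power_geometry.

Lemma normal_convex_unique_joins (R : realType) (d : nat) (M : riemannian 'rV[R]_d)
  (U : set M) : normal_convex U -> unique_joins U.
Proof.
move=> [_ _ H] p q c c' gc jc gc' jc' t t01.
have I0 : 0 <= (0 : R) <= 1 by rewrite lexx ler01.
have I1 : 0 <= (1 : R) <= 1 by rewrite lexx ler01.
have Up : U p by have [<- _ cU] := jc; exact: cU.
have Uq : U q by have [_ <- cU] := jc; exact: cU.
have [c0 _ [u0 _]] := H p q Up Uq.
by rewrite (u0 _ gc jc) // (u0 _ gc' jc').
Qed.

Theorem proposition1 (R : realType) (d : nat) (M : riemannian 'rV[R]_d)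
    (U : set M) (hU : normal_convex U) (n : nat) (hn : (1 <= n)%N)
    (mu : power M n) (hmu : power_set U n mu)
    (S W : {linear tangent mu -> tangent mu})
    (S_selfadjoint : forall u v : tangent mu,
       metric (S u) v = metric u (S v))
    (S_posdef : forall v : tangent mu, v != 0 -> 0 < metric (S v) v)
    (W_posdef : forall v : tangent mu, v != 0 -> 0 < metric (W v) v)
    (WtW : forall v : tangent mu, adjoint W (W v) = S v)
    (f : power M n -> R)
    (hf : forall y : power M n, power_set U n y ->
       f y = metric (S (Log (power_set U n) mu y))
                    (Log (power_set U n) mu y))
    (x : power M n) (hx : power_set U n x)
    (gamma : R -> power M n)
    (hgamma : forall t : R, 0 <= t <= 1 ->
       gamma t = Exp (t *: Log (power_set U n) mu x)) :
  [/\ differentiable_vec (Log (power_set U n) mu) x,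
      differentiable_vec f x &
      grad f x =
        2 *: adjoint (diff_vec (Log (power_set U n) mu) x)
                     (S (Log (power_set U n) mu x))] /\
  (forall k : power M n -> power M n,
     (forall y : power M n, power_set U n y ->
        k y = Exp (W (Log (power_set U n) mu y))) ->
     (exists2 y : power M n, power_set U n y &
        Log (power_set U n) mu y = W (Log (power_set U n) mu x)) ->
     differentiable_map k x /\
     grad f x =
       - 2 *: adjoint (diff_map k x) (Log (power_set U n) (k x) mu)).
Proof.
have [oU nU _] := hU.
apply: gradient_squared_norm_log => //.
- exact: (power_box_open (D := fun=> U)).
- by apply: power_unique_joins; exact: normal_convex_unique_joins.
- by apply: power_normal_neighborhood => // i; exact: nU.
Qed.
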